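(* The cluster algebra $\mathbb{C}[\mathbb{G}(3,8)]$ possesses exactly $128$ cluster variables. Of these, forty-eight are the Plücker coordinates $\Delta^{ijk}$ with $\{i,j,k\}\subset[1\dots8]$ an internal $3$-subset; fifty-six are the quadratic regular functions $X^{[1\dots8]-\{ij\}}$ and $Y^{[1\dots8]-\{ij\}}$ for $1\le i<j\le8$; and the remaining twenty-four are dihedral translates (up to sign) of the two cubic regular functions $A$ and $B$. The zero locus of $A$ consists of the configurations of eight projective points $[v_1],\dots,[v_8]$ for which the points $p$, $q$ and $[v_5]$ are collinear, where $p$ is the intersection point of the line joining $[v_1]$ with $[v_2]$ and the line joining $[v_3]$ with $[v_4]$, and $q$ is the intersection point of the line joining $[v_1]$ with $[v_8]$ and the line joining $[v_6]$ with $[v_7]$.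
   Context: Grassmannian. $X(k,n)\subset\bigwedge^k\mathbb{C}^n$ is the affine cone of decomposable $k$-forms, with Plücker coordinates $\Delta^K$ indexed by $k$-subsets $K\subset\{1,\dots,n\}$. $\mathbb{C}[\mathbb{G}(k,n)]$ denotes the coordinate ring of $X(k,n)$. A $k$-subset is internal if it is not a cyclic interval modulo $n$. A point of $\mathbb{G}(3,8)$ is represented by a real $3\times 8$ matrix $(v_1\ \dots\ v_8)$ with nonzero columns; to it is associated the configuration $[v_1],\dots,[v_8]$ in $\mathbb{RP}^2$; $\Delta^{abc}=\det(v_a\ v_b\ v_c)$ for $a<b<c$. The description of the zero locus of $A$ refers to configurations for which the lines and intersection points mentioned are defined. The dihedral group $D_8$ acts by permuting the columns of the matrix according to its action on $[1\dots8]$ as symmetries of a regular octagon; dihedral translates of a function are its images under this action. The functions $X$ and $Y$. On $\mathbb{G}(3,6)$ put $X^{123456}=\Delta^{134}\Delta^{256}-\Delta^{156}\Delta^{234}$ and $Y^{123456}=\Delta^{145}\Delta^{236}-\Delta^{123}\Delta^{456}$. For $I\subset[1\dots n]=\{1,\dots,n\}$ with complement $\{a_1<\dots<a_6\}$, $X^{[1\dots n]-I}$ and $Y^{[1\dots n]-I}$ are obtained by composing with the projection $\mathbb{G}(3,n)\to\mathbb{G}(3,6)$ forgetting the columns indexed by $I$, i.e. by replacing the index $r$ by $a_r$. The functions $A$ and $B$: $A=\Delta^{134}\big(\Delta^{258}\Delta^{167}-\Delta^{678}\Delta^{125}\big)-\Delta^{158}\Delta^{234}\Delta^{167}$, $B=\Delta^{258}\Delta^{134}\Delta^{267}-\Delta^{234}\big(\Delta^{128}\Delta^{567}+\Delta^{258}\Delta^{167}\big)$.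 Seeds and mutation. A seed in a field $\mathcal{F}$ of rational functions over $\mathbb{C}$ in $M$ variables is a triple $(\mathbf{x},\mathbf{c},\tilde B)$ where $\tilde{\mathbf{x}}=\mathbf{x}\sqcup\mathbf{c}$ is a transcendence basis of $\mathcal{F}$ ($M$ algebraically independent elements) and $\tilde B=(b_{x,y})$ is an integer matrix with rows indexed by $\tilde{\mathbf x}$ and columns by $\mathbf{x}$ whose square submatrix with rows in $\mathbf{x}$ is skew-symmetrizable. For $z\in\mathbf{x}$, $\mu_z(\mathbf{x},\mathbf{c},\tilde B)=(\mathbf{x}-\{z\}\cup\{z'\},\mathbf{c},\tilde B')$, where $zz'=\prod_{b_{x,z}>0}x^{b_{x,z}}+\prod_{b_{x,z}<0}x^{-b_{x,z}}$ and $b'_{x,y}=-b_{x,y}$ if $x=z$ or $y=z$, $b'_{x,y}=b_{x,y}+\frac{|b_{x,z}|b_{z,y}+b_{x,z}|b_{z,y}|}{2}$ otherwise (index $z$ renamed $z'$). Clusters are the sets $\mathbf{x}$ in seeds obtained from an initial seed by iterated mutation; their elements are the cluster variables. Cluster structure on $\mathbb{C}[\mathbb{G}(k,n)]$ (here $k=3$, $n=8$). $\mathcal{F}$ is the fraction field of $\mathbb{C}[\mathbb{G}(k,n)]$. For $0\le i\le k$, $0\le j\le n-k$ put $p_{ij}=n-k-\lfloor\frac{i+j-2}{2}\rfloor$, $p'_{ij}=n-k+2+\lfloor\frac{i+j-1}{2}\rfloor$ and $I_{ij}=\{p_{ij},\dots,p_{ij}+i-1\}\sqcup\{p'_{ij},\dots,p'_{ij}+k-i-1\}$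 (mod $n$; only non-corner pairs $(i,j)$ are used). The initial cluster is $\{\Delta^{I_{ij}}: 1\le i\le k-1,\ 1\le j\le n-k-1\}$; the coefficients $\mathbf{c}$ are the $\Delta^{K}$ for the $n$ cyclic intervals $K$ of length $k$ (these are the $I_{ij}$ with $i\in\{0,k\}$ or $j\in\{0,n-k\}$). In the column of $\tilde B$ indexed by $I_{ij}$ the entries in rows $I_{i\pm1,j}$ equal $(-1)^{i+j}$, the entries in rows $I_{i,j\pm1}$ equal $-(-1)^{i+j}$, and all other entries are $0$. *)

(* Defs.v *)
(* The mathematical label l in {1, ..., n} of a column is represented by the
   element i : 'I_n with i.+1 = l. *)
From HB Require Import structures.
From mathcomp Require Import all_boot all_order all_algebra all_fingroup.
From mathcomp Require Import generic_quotient ring_quotient fraction.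
From mathcomp.classical Require Import boolp classical_sets cardinality.
From mathcomp.multinomials Require Import mpoly.

Set Implicit Arguments.
Unset Strict Implicit.
Unset Printing Implicit Defensive.

Import Order.TTheory GRing.Theory Num.Theory.
Local Open Scope ring_scope.
Local Open Scope quotient_scope.

Definition ksubset (k n : nat) := {K : {set 'I_n} | #|K| == k}.

(* The elements of K in increasing order. *)
Definition ksubset_elt (k n : nat) (K : ksubset k n) (i : 'I_k) : 'I_n :=
  enum_val (cast_ord (esym (eqP (valP K))) i).

(* An element of the k-th exterior power of C^n is given by its coordinates in
   the basis e_K; those of the wedge product of the rows of M are the maximal
   minors of M. *)
Definition plucker (C : pzRingType) (k n : nat) (M : 'M[C]_(k, n)) :
    {ffun ksubset k n -> C} :=
  [ffun K => \det (colsub (ksubset_elt K) M)].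

Definition decomposable (C : pzRingType) (k n : nat)
    (w : {ffun ksubset k n -> C}) : Prop :=
  exists M : 'M[C]_(k, n), w = plucker M.

Definition wedge_poly (C : nzRingType) (k n : nat) :=
  {mpoly C[#|{: ksubset k n}|]}.

Definition wedge_eval (C : nzRingType) (k n : nat) (p : wedge_poly C k n)
    (w : {ffun ksubset k n -> C}) : C :=
  p.@[fun i => w (enum_val i)].

Definition vanishing (C : nzRingType) (k n : nat) : pred (wedge_poly C k n) :=
  fun p => `[< forall w, decomposable w -> wedge_eval p w = 0 >].

Section VanishingIdeal.
Variables (C : numFieldType) (k n : nat).
Implicit Types (p q : wedge_poly C k n) (M N : 'M[C]_(k, n)).

Let minor_poly M N (K : ksubset k n) : {poly C} :=
  \det (colsub (ksubset_elt K)
          (map_mx polyC M + 'X *: map_mx polyC (N - M))).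

Let line_poly M N p : {poly C} :=
  \sum_(m <- msupp p) (p@_m)%:P * \prod_i minor_poly M N (enum_val i) ^+ m i.

Let horner_line_poly M N p t :
  (line_poly M N p).[t] = wedge_eval p (plucker (M + t *: (N - M))).
Proof.
rewrite /line_poly /wedge_eval mevalE horner_sum; apply: eq_bigr => m _.
rewrite hornerCM horner_prod; congr (_ * _); apply: eq_bigr => i _.
rewrite horner_exp ffunE /minor_poly -horner_evalE -det_map_mx.
congr (\det _ ^+ _); apply/matrixP => a b.
by rewrite !mxE /= horner_evalE !hornerE.
Qed.

Let exists_nonroot (p : {poly C}) : p != 0 -> exists t, p.[t] != 0.
Proof.
move=> p0; apply: contrapT => h.
have r t : root p t.
  by apply/eqP; apply: contrapT => /eqP pt; apply: h; exists t.
have u : uniq [seq i%:R : C | i <- iota 0 (size p)].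
  by rewrite map_inj_uniq ?iota_uniq // => i j /eqP; rewrite eqr_nat => /eqP.
suff a : all (root p) [seq i%:R : C | i <- iota 0 (size p)].
  by have := max_poly_roots p0 a u; rewrite size_map size_iota ltnn.
by apply/allP => x _; exact: r.
Qed.

Lemma vanishingP p :
  reflect (forall M, wedge_eval p (plucker M) = 0) (p \in @vanishing C k n).
Proof.
apply: (iffP (asboolP _)) => [h M|h w [M ->]]; last exact: h.
by apply: h; exists M.
Qed.

Lemma vanishing_idealr : idealr_closed (@vanishing C k n).
Proof.
split.
- by apply/vanishingP => M; rewrite /wedge_eval meval0.
- apply/negP => /vanishingP v1; have := v1 0; rewrite /wedge_eval meval1.
  by move/eqP; rewrite oner_eq0.
move=> a p q /vanishingP pI /vanishingP qI; apply/vanishingP => M.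
have := pI M; have := qI M; rewrite /wedge_eval mevalD mevalM => -> ->.
by rewrite mulr0 addr0.
Qed.

Lemma vanishing_prime : prime_idealr_closed (@vanishing C k n).
Proof.
have nonvanishing p : p \notin @vanishing C k n ->
    exists M, wedge_eval p (plucker M) != 0.
  move=> pN; apply: contrapT => h; move/negP: pN; apply; apply/vanishingP => M.
  by apply: contrapT => /eqP pM; apply: h; exists M.
move=> p q /vanishingP pq; apply/orP; apply: contrapT => /not_orP[].
move=> /negP/nonvanishing[M pM] /negP/nonvanishing[N qN].
have pL : line_poly M N p != 0.
  apply: contra_neq pM => L0; have := horner_line_poly M N p 0.
  by rewrite L0 horner0 scale0r addr0.
have qL : line_poly M N q != 0.
  apply: contra_neq qN => L0; have := horner_line_poly M N q 1.
  by rewrite L0 horner0 scale1r addrC subrK.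
have [t] := exists_nonroot (mulf_neq0 pL qL).
rewrite hornerM !horner_line_poly => /negP; apply; apply/eqP.
by rewrite -mevalM; exact: pq.
Qed.

HB.instance Definition _ :=
  isIdealr.Build (wedge_poly C k n) (@vanishing C k n) vanishing_idealr.
HB.instance Definition _ := isPrimeIdealrClosed.Build (wedge_poly C k n)
  (@vanishing C k n) vanishing_prime.

End VanishingIdeal.

Definition coordring (C : numFieldType) (k n : nat) :=
  {ideal_quot (@vanishing C k n : prime_idealr (wedge_poly C k n))}.

HB.instance Definition _ C k n := GRing.ComNzRing.on (@coordring C k n).

Section IntegralDomain.
Variables (C : numFieldType) (k n : nat).
Local Notation A := (coordring C k n).

Let unit : pred A := fun x => `[< exists y, y * x = 1 >].
Let inv (x : A) : A :=
  if pselect (exists y, y * x = 1) is left e then sval (cid e) else x.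

Let mulVx : {in unit, left_inverse 1 inv *%R}.
Proof.
move=> x /asboolP ex; rewrite /inv; case: pselect => // e.
exact: (svalP (cid e)).
Qed.

Let unitPl (x y : A) : y * x = 1 -> x \in unit.
Proof. by move=> yx; apply/asboolP; exists y. Qed.

Let inv_out : {in [predC unit], inv =1 id}.
Proof.
move=> x; rewrite inE /= => /asboolPn nx.
by rewrite /inv; case: pselect.
Qed.

HB.instance Definition _ := GRing.ComNzRing_hasMulInverse.Build A
  mulVx unitPl inv_out.

Let mulf_eq0_axiom (x y : A) : x * y = 0 -> (x == 0) || (y == 0).
Proof. exact: Quotient.rquot_IdomainAxiom. Qed.

HB.instance Definition _ := GRing.ComUnitRing_isIntegral.Build A
  mulf_eq0_axiom.

End IntegralDomain.

Definition regular_const (C : numFieldType) (k n : nat) (c : C) :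
    coordring C k n :=
  \pi_(coordring C k n) (c%:MP : wedge_poly C k n).

(* Well defined on decomposable w only, see regular_evalE. *)
Definition regular_eval (C : numFieldType) (k n : nat) (f : coordring C k n)
    (w : {ffun ksubset k n -> C}) : C :=
  wedge_eval (repr f) w.

Lemma regular_evalE (C : numFieldType) (k n : nat) (p : wedge_poly C k n)
    (M : 'M[C]_(k, n)) :
  regular_eval (\pi_(coordring C k n) p) (plucker M) = wedge_eval p (plucker M).
Proof.
have : p == repr (\pi_(coordring C k n) p) %[mod coordring C k n].
  by rewrite reprK.
rewrite -Quotient.idealrBE => /vanishingP v; have := v M.
by rewrite /regular_eval /wedge_eval mevalB => /eqP; rewrite subr_eq0 => /eqP.
Qed.

Notation ratfun C k n := {fraction (coordring C k n)}.

Definition frac_of (C : numFieldType) (k n : nat) (f : coordring C k n) :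
    ratfun C k n := FracField.tofrac f.

Definition ratfun_const (C : numFieldType) (k n : nat) (c : C) : ratfun C k n :=
  frac_of (regular_const k n c).

(* The function K |-> Delta^K, extended by 0 to sets of cardinality other
   than k. *)
Definition Delta (C : numFieldType) (k n : nat) (K : {set 'I_n}) :
    coordring C k n :=
  if insub K is Some K' then
    \pi_(coordring C k n)
      ('X_(enum_rank (K' : ksubset k n)) : wedge_poly C k n)
  else 0.

Section Seeds.
Variables (C F : fieldType) (e : C -> F).

Definition alg_independent (T : finType) (x : T -> F) : Prop :=
  forall p : {mpoly C[#|T|]}, mmap e (fun i => x (enum_val i)) p = 0 -> p = 0.

(* A maximal algebraically independent family. *)
Definition transcendence_basis (T : finType) (x : T -> F) : Prop :=
  alg_independent x /\
  forall f : F, ~ alg_independent (fun o : option T => oapp x f o).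

(* Seeds are labelled: I labels the cluster and J the coefficients, and the
   variable replacing z in a mutation inherits the label of z. *)
Record seed_data (I J : finType) := SeedData {
  cluster : I -> F;
  coefficients : J -> F;
  exchange : I + J -> I -> int
}.

Variables I J : finType.
Implicit Types (s : seed_data I J) (z : I).

Definition extended_cluster s (r : I + J) : F :=
  match r with inl i => cluster s i | inr j => coefficients s j end.

Definition skew_symmetrizable (b : I -> I -> int) : Prop :=
  exists2 d : I -> int, (forall i, 0 < d i) &
    forall i j, d i * b i j = - (d j * b j i).

Definition is_seed s : Prop :=
  transcendence_basis (extended_cluster s) /\
  skew_symmetrizable (fun i j => exchange s (inl i) j).

Definition exchange_numerator s z : F :=
  \prod_(r | 0 < exchange s r z) extended_cluster s r ^+ `|exchange s r z|%N +
  \prod_(r | exchange s r z < 0) extended_cluster s r ^+ `|exchange s r z|%N.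

Definition mutate z s : seed_data I J := {|
  cluster i := if i == z then exchange_numerator s z / cluster s z
               else cluster s i;
  coefficients := coefficients s;
  exchange r y :=
    if (r == inl z) || (y == z) then - exchange s r y
    else exchange s r y +
      ((`|exchange s r z| * exchange s (inl z) y +
        exchange s r z * `|exchange s (inl z) y|) %/ 2)%Z
|}.

(* Mutation preserves is_seed, so it is only required of the initial data. *)
Inductive mutation_equivalent s0 : seed_data I J -> Prop :=
| MutationRefl : is_seed s0 -> mutation_equivalent s0 s0
| MutationStep s z :
    mutation_equivalent s0 s -> mutation_equivalent s0 (mutate z s).

Definition cluster_variable s0 : set F :=
  [set x | exists s z, mutation_equivalent s0 s /\ x = cluster s z].

End Seeds.

(* {a, a + 1, ..., a + l - 1} modulo n, as a set of labels. *)
Definition cyclic_interval (n : nat) (a : int) (l : nat) : {set 'I_n} :=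
  [set x : 'I_n | [exists t : 'I_l, ((x.+1)%:Z == a + t%:Z %[mod n])%Z]].

Definition internal (k n : nat) (K : {set 'I_n}) : bool :=
  (#|K| == k) && ~~ [exists a : 'I_n, K == cyclic_interval n (a.+1)%:Z k].

(* %/ is the floor division of integers. *)
Definition grid_set (k n i j : nat) : {set 'I_n} :=
  let p := n%:Z - k%:Z - ((i%:Z + j%:Z - 2) %/ 2)%Z in
  let p' := n%:Z - k%:Z + 2 + ((i%:Z + j%:Z - 1) %/ 2)%Z in
  cyclic_interval n p i :|: cyclic_interval n p' (k - i).

(* The cluster label (i, j) stands for the pair (i + 1, j + 1). *)
Definition grassmannian_seed (C : numFieldType) (k n : nat) :
    seed_data (ratfun C k n) ('I_k.-1 * 'I_(n - k).-1)%type 'I_n :=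
  let mutable_set (c : 'I_k.-1 * 'I_(n - k).-1) :=
    grid_set k n c.1.+1 c.2.+1 in
  let coefficient_set (a : 'I_n) := cyclic_interval n (a.+1)%:Z k in
  {| cluster c := frac_of (Delta C k (mutable_set c));
     coefficients a := frac_of (Delta C k (coefficient_set a));
     exchange r c :=
       let K := match r with inl c' => mutable_set c'
                           | inr a => coefficient_set a end in
       let i := c.1.+1 in let j := c.2.+1 in
       if K \in [:: grid_set k n i.+1 j; grid_set k n i.-1 j]
       then (-1) ^+ (i + j)
       else if K \in [:: grid_set k n i j.+1; grid_set k n i j.-1]
       then - (-1) ^+ (i + j)
       else 0 |}.

Definition grassmannian_cluster_variable (C : numFieldType) (k n : nat) :
    set (ratfun C k n) :=
  cluster_variable (@ratfun_const C k n) (grassmannian_seed C k n).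
Arguments grassmannian_cluster_variable : clear implicits.

Section Functions.
Variables (C : numFieldType) (n : nat).

Definition Delta3 (a b c : nat) : coordring C 3 n :=
  Delta C 3 [set x : 'I_n | x.+1 \in [:: a; b; c]].

(* The label a_r of the r-th element of the complement of I (r >= 1). *)
Definition complement_label (I : {set 'I_n}) (r : nat) : nat :=
  nth 0%N [seq (x : 'I_n).+1 | x <- enum (~: I)] r.-1.

Local Notation D I r s t :=
  (Delta3 (complement_label I r%N) (complement_label I s%N)
          (complement_label I t%N)).

Definition X_minus (I : {set 'I_n}) : coordring C 3 n :=
  D I 1 3 4 * D I 2 5 6 - D I 1 5 6 * D I 2 3 4.

Definition Y_minus (I : {set 'I_n}) : coordring C 3 n :=
  D I 1 4 5 * D I 2 3 6 - D I 1 2 3 * D I 4 5 6.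

End Functions.

Section CubicFunctions.
Variable C : numFieldType.
Local Notation D a b c := (Delta3 C 8 a%N b%N c%N).

Definition cubicA : coordring C 3 8 :=
  D 1 3 4 * (D 2 5 8 * D 1 6 7 - D 6 7 8 * D 1 2 5) - D 1 5 8 * D 2 3 4 * D 1 6 7.

Definition cubicB : coordring C 3 8 :=
  D 2 5 8 * D 1 3 4 * D 2 6 7 - D 2 3 4 * (D 1 2 8 * D 5 6 7 + D 2 5 8 * D 1 6 7).

End CubicFunctions.

(* Rotations and reflections of the regular n-gon with vertices 'I_n. *)
Definition dihedral (n : nat) : {set 'S_n} :=
  [set s : 'S_n | [exists c : 'I_n,
     [forall x, s x == ((x + c) %% n)%N :> nat] ||
     [forall x, s x == ((c + n - x) %% n)%N :> nat]]].

Definition column_translate (C : numFieldType) (k n : nat) (s : 'S_n)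
    (f g : coordring C k n) : Prop :=
  forall M : 'M[C]_(k, n),
    regular_eval g (plucker M) = regular_eval f (plucker (col_perm s M)).

Definition dihedral_translate (C : numFieldType) (k n : nat)
    (f g : coordring C k n) : Prop :=
  exists2 s, s \in dihedral n & column_translate s f g.

Section ProjectivePlane.
Variable R : fieldType.
Local Open Scope vspace_scope.

(* Points and lines of the projective plane are the subspaces of dimension 1
   and 2 of the space of column vectors of height 3. *)
Definition proj_point (v : 'cV[R]_3) : {vspace 'cV[R]_3} := <[v]>.

Definition joining_line (p q : {vspace 'cV[R]_3}) := p + q.

Definition intersection_point (l m : {vspace 'cV[R]_3}) := l :&: m.

Definition collinear (p q r : {vspace 'cV[R]_3}) : Prop :=
  exists l : {vspace 'cV[R]_3}, \dim l = 2%N /\ (p <= l /\ q <= l /\ r <= l).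

End ProjectivePlane.

(* Main.v *)
Require Import Defs.
From HB Require Import structures.
From Stdlib Require Import ZArith FMapPositive Ring_polynom Ring_theory InitialRing.
From mathcomp Require Import all_boot all_order all_algebra all_fingroup.
From mathcomp Require Import generic_quotient ring_quotient fraction zify ring.
From mathcomp.classical Require Import classical_sets cardinality.
From mathcomp.multinomials Require Import mpoly.
From mathcomp Require Import reals.
From mathcomp.real_closed Require Import complex.

(** The cluster structure on the cone of decomposable forms is of finite type
    (E8, with 25080 seeds), and the rotation of the octagon permutes the seeds.
    The 128 expected cluster variables and the 8 coefficients are listed in
    advance, as 17 rotation orbits of eight functions each, a function being
    named by a positive number that encodes its orbit and its place there
    ([formula_of]). Two facts then have to be established: nothing else is a
    cluster variable, and each name is reached.

    Nothing else occurs because the mutation of seeds can be followed on names.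
    A combinatorial seed records the names of a cluster together with, for each
    of them, the two monomials of its exchange relation. When the two monomials
    and the exchanged pair belong to a list of 390 relations, up to rotation,
    that hold between the named functions ([regular_relations]), the
    combinatorial mutation computes the actual one ([realizes_mutate]). So it
    is enough that an exhaustive search from the initial seed, which identifies
    seeds that differ by a rotation and finds 3148 classes, never leaves that
    list ([exploration_terminates], [realizes_exploration]). Each name is
    reached because nine mutations lead to a seed whose quiver is a tree with an
    alternating orientation, and the mutations at its sources, then at its sinks,
    and so on, run through all cluster variables ([bipartite_belt_covers]).

    The relations are polynomial identities between the minors of a 3 x 8
    matrix. Multiplication on the left by a matrix of determinant 1 brings a
    matrix with independent first columns to a normal form with sixteen
    parameters and the same minors, and matrices with dependent first columns
    can be neglected because the coordinate ring is a domain ([chart_ext]).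
    In the normal form the identities are verified by expanding them. That the
    128 functions are distinct is seen on a single integer matrix
    ([sample_values_distinct]).

    Mutation equivalence presupposes that the initial data form a seed. The
    sixteen initial functions are algebraically independent because they can
    be prescribed arbitrarily, as long as they do not vanish
    ([initial_minors_free]). They form a maximal independent family because all
    Pluecker coordinates are cluster variables or coefficients, hence rational
    functions of them ([rational_frac]).

    The reflections of the octagon change the sign of each minor, so they map
    the cubic functions to cluster variables only up to sign
    ([cubic_translate_id]). Finally, writing p and q as combinations of v1, v2
    and of v1, v8 that lie on the two other lines, det (p, q, v5) is the
    opposite of A ([cubicA_det3]). *)

Set Implicit Arguments.
Unset Strict Implicit.
Unset Printing Implicit Defensive.

Import Order.TTheory GRing.Theory Num.Theory.
Local Open Scope ring_scope.
Local Open Scope quotient_scope.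

(** * Combinatorial seeds *)

Lemma positive_eqP : Equality.axiom Pos.eqb.
Proof. by move=> x y; apply: (iffP idP) => /Pos.eqb_eq. Qed.
HB.instance Definition _ := hasDecEq.Build positive positive_eqP.

(** A positive number [q~b2~b1~b0] names the function number b2 b1 b0 (in
    binary) of the orbit q; orbit 1 consists of the coefficients, orbits 2 to 17
    of the cluster variables. The encoding makes the rotation of a name a
    constant-time operation. *)
Definition rotate1 (x : positive) : positive :=
  match x with
  | q~0~0~0 => q~0~0~1 | q~0~0~1 => q~0~1~0 | q~0~1~0 => q~0~1~1
  | q~0~1~1 => q~1~0~0 | q~1~0~0 => q~1~0~1 | q~1~0~1 => q~1~1~0
  | q~1~1~0 => q~1~1~1 | q~1~1~1 => q~0~0~0
  | _ => x
  end%positive.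

Definition rotate (k : nat) (x : positive) : positive := iter k rotate1 x.

Definition orbit_number (x : positive) : positive := Pos.div2 (Pos.div2 (Pos.div2 x)).

Definition is_cluster_id (x : positive) : bool :=
  Pos.leb 2 (orbit_number x) && Pos.ltb (orbit_number x) 18.

Definition id_range (a n : nat) : seq positive := [seq Pos.of_nat i | i <- iota a n].

Definition cluster_ids : seq positive := id_range 16 128.

(** The first eight are the coefficients. *)
Definition all_ids : seq positive := id_range 8 136.

(** The column of a name z in an exchange matrix, as the pair of the monomials on
    the right-hand side of its exchange relation. A monomial is a list of names,
    repeated according to their exponents. *)
Notation column := (seq positive * seq positive)%type.
Notation combinatorial_seed := (seq (positive * column)).

Definition opposite (c : column) : column := (c.2, c.1).

(** Lists are kept sorted so that equal monomials are equal lists. *)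
Definition rotate_column (k : nat) (c : column) : column :=
  (sort Pos.leb (map (rotate k) c.1), sort Pos.leb (map (rotate k) c.2)).

Definition rotate_seed (k : nat) (s : combinatorial_seed) : combinatorial_seed :=
  sort (fun e f => Pos.leb e.1 f.1)
    [seq (rotate k e.1, rotate_column k e.2) | e <- s].

(** Cancelling common factors makes the two monomials determine the column:
    an entry of the exchange matrix is the difference of the two multiplicities. *)
Fixpoint cancel_common (p n : seq positive) : column :=
  if p is x :: p' then
    if x \in n then cancel_common p' (rem x n)
    else let: (p'', n'') := cancel_common p' n in (x :: p'', n'')
  else ([::], n).

(** Column of y after the mutation at z, where [cz] is the column of z and [c]
    that of y. If b is the entry of [c] in row z, then b copies of the first
    monomial of z (for b > 0), or -b copies of its second monomial (for b < 0),
    are added to the corresponding monomial, and z becomes z' on the opposite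
    side. *)
Definition mutate_column (z z' : positive) (cz c : column) : column :=
  let: (p, n) := c in
  let a := count_mem z p in
  let b := count_mem z n in
  if (a == 0) && (b == 0) then c else
  cancel_common
    (filter (predC1 z) p ++ flatten (nseq a cz.1) ++ nseq b z')
    (filter (predC1 z) n ++ flatten (nseq b cz.2) ++ nseq a z').

(** For each name z, the pairs of a name z' and the two monomials whose sum is
    z z'. *)
Definition exchanges := PositiveMap.t (seq (positive * column)).

Definition exchanges_of (T : exchanges) (z : positive) : seq (positive * column) :=
  odflt [::] (PositiveMap.find z T).

Definition add_exchange (z z' : positive) (c : column) (T : exchanges) : exchanges :=
  PositiveMap.add z ((z', c) :: exchanges_of T z) T.

(** Exchange relations are symmetric in their two monomials, whereas the column
    is a signed object: hence the test up to [opposite]. *)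
Definition exchange_partner (T : exchanges) (z : positive) (c : column) :
    option positive :=
  ohead [seq e.1 | e <- exchanges_of T z & (e.2 == c) || (e.2 == opposite c)].

(** The new name is looked up rather than computed, which is what makes a search on
    names possible; a missing relation counts as a failure. *)
Definition mutate_seed (T : exchanges) (z : positive) (cz : column)
    (s : combinatorial_seed) : option combinatorial_seed :=
  if exchange_partner T z (sort Pos.leb cz.1, sort Pos.leb cz.2) is Some z' then
    if z' \in [seq e.1 | e <- s] then None else
    Some [seq if e.1 == z then (z', opposite cz)
              else (e.1, mutate_column z z' cz e.2) | e <- s]
  else None.

Fixpoint lex_lt (a b : seq positive) : bool :=
  match a, b with
  | x :: a', y :: b' => match Pos.compare x y with
                        | Lt => true | Eq => lex_lt a' b' | Gt => false end
  | _, _ => false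
  end.

(** Any choice of a rotation is correct; choosing the smallest list identifies the
    seeds of an orbit, which keeps the search small. *)
Definition canonical_rotation (ids : seq positive) : nat :=
  let best := foldl (fun best k =>
    let ids' := sort Pos.leb (map (rotate k) ids) in
    if lex_lt ids' best.2 then (k, ids') else best)
    (0, sort Pos.leb ids) (iota 1 7) in
  best.1.

Definition canonical_seed (s : combinatorial_seed) : combinatorial_seed :=
  rotate_seed (canonical_rotation (map fst s)) s.

Fixpoint append_bits (x h : positive) : positive :=
  match x with
  | xH => xI h
  | xO x => xO (append_bits x h)
  | xI x => xI (append_bits x h)
  end.

(** Distinct seeds with the same key would make the search fail, so the key can be
    any hash. *)
Definition seed_key (s : combinatorial_seed) : positive :=
  foldr (fun e h => append_bits e.1 h) xH s.

Definition seed_table := PositiveMap.t combinatorial_seed.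

(** None means that an exchange relation is missing or that two keys collide. *)
Fixpoint visit_neighbours (T : exchanges) (s es : combinatorial_seed)
    (V : seed_table) (W : seq combinatorial_seed) :
    option (seed_table * seq combinatorial_seed) :=
  if es is (z, c) :: es' then
    if mutate_seed T z c s is Some s' then
      let t := canonical_seed s' in
      let h := seed_key t in
      if PositiveMap.find h V is Some t' then
        if t == t' then visit_neighbours T s es' V W else None
      else visit_neighbours T s es' (PositiveMap.add h t V) (t :: W)
    else None
  else Some (V, W).

Fixpoint explore (T : exchanges) (fuel : nat) (V : seed_table)
    (W : seq combinatorial_seed) : option seed_table :=
  if fuel is n.+1 then
    if W is s :: W' then
      if visit_neighbours T s s V W' is Some (V', W'') then explore T n V' W''
      else None
    else Some V
  else None.

Definition relation := (positive * positive * seq positive * seq positive)%type.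

(** Representatives, up to rotation, of the exchange relations z z' = p + n, as
    quadruples (z, z', p, n). *)
Definition relations : seq relation := [::
(16,17,[:: 8; 43],[:: 9; 24]);
(16,25,[:: 8; 49],[:: 9; 32]);
(16,30,[:: 8; 38],[:: 68]);
(16,33,[:: 8; 57],[:: 9; 40]);
(16,37,[:: 8; 45],[:: 84]);
(16,41,[:: 8; 55],[:: 9; 15]);
(16,44,[:: 8; 11],[:: 70]);
(16,48,[:: 8; 35],[:: 24; 42]);
(16,50,[:: 8; 19],[:: 103]);
(16,54,[:: 8; 62],[:: 40; 42]);
(16,56,[:: 8; 59],[:: 32; 42]);
(16,58,[:: 8; 27],[:: 108]);
(16,61,[:: 8; 51],[:: 76]);
(16,67,[:: 8; 100],[:: 9; 15; 21]);
(16,69,[:: 8; 31; 43],[:: 9; 15; 35]);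
(16,71,[:: 8; 43; 45],[:: 9; 87]);
(16,73,[:: 8; 65],[:: 120]);
(16,75,[:: 8; 113],[:: 9; 15; 52]);
(16,77,[:: 8; 43; 62],[:: 9; 35; 40]);
(16,79,[:: 8; 35; 45],[:: 42; 87]);
(16,80,[:: 8; 72],[:: 9; 66]);
(16,83,[:: 8; 94],[:: 9; 15; 28]);
(16,85,[:: 8; 38; 43],[:: 9; 82]);
(16,88,[:: 8; 38; 49],[:: 9; 74]);
(16,91,[:: 8; 118],[:: 9; 28; 40]);
(16,93,[:: 8; 35; 38],[:: 42; 82]);
(16,95,[:: 8; 87],[:: 24; 84]);
(16,96,[:: 8; 43; 51],[:: 9; 90]);
(16,99,[:: 8; 104],[:: 42; 66]);
(16,101,[:: 8; 82],[:: 24; 68]);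
(16,102,[:: 8; 31; 49],[:: 9; 15; 59]);
(16,106,[:: 8; 74],[:: 32; 68]);
(16,107,[:: 8; 31; 57],[:: 9; 15; 62]);
(16,109,[:: 8; 43; 59],[:: 9; 32; 35]);
(16,111,[:: 8; 27; 45],[:: 123]);
(16,112,[:: 8; 38; 59],[:: 42; 74]);
(16,114,[:: 8; 90],[:: 24; 76]);
(16,115,[:: 8; 49; 62],[:: 9; 40; 59]);
(16,117,[:: 8; 35; 51],[:: 42; 90]);
(16,119,[:: 8; 98],[:: 128]);
(16,121,[:: 8; 43; 74],[:: 9; 32; 82]);
(16,122,[:: 8; 130],[:: 9; 15; 97]);
(16,124,[:: 8; 43; 104],[:: 9; 35; 66]);
(16,126,[:: 8; 45; 82],[:: 68; 87]);
(16,127,[:: 8; 31; 72],[:: 9; 15; 104]);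
(16,131,[:: 8; 27; 87],[:: 24; 123]);
(16,132,[:: 8; 49; 104],[:: 9; 59; 66]);
(16,134,[:: 8; 51; 82],[:: 68; 90]);
(16,135,[:: 8; 31; 118],[:: 9; 15; 28; 62]);
(16,136,[:: 8; 62; 72],[:: 9; 40; 104]);
(16,138,[:: 8; 35; 74],[:: 32; 42; 82]);
(16,139,[:: 8; 57; 94],[:: 9; 15; 118]);
(16,140,[:: 8; 123],[:: 84; 108]);
(16,141,[:: 8; 38; 43; 59],[:: 9; 35; 74]);
(16,143,[:: 8; 45; 90],[:: 76; 87]);
(24,25,[:: 8; 36],[:: 17; 32]);
(24,26,[:: 10; 40],[:: 103]);
(24,33,[:: 8; 60],[:: 17; 40]);
(24,34,[:: 10; 15],[:: 108]);
(24,37,[:: 8; 12],[:: 95]);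
(24,38,[:: 16; 46],[:: 82]);
(24,41,[:: 8; 63],[:: 15; 17]);
(24,45,[:: 12; 16],[:: 87]);
(24,49,[:: 16; 36],[:: 32; 43]);
(24,51,[:: 16; 20],[:: 90]);
(24,54,[:: 8; 52],[:: 40; 48]);
(24,55,[:: 15; 43],[:: 16; 63]);
(24,56,[:: 8; 28],[:: 32; 48]);
(24,57,[:: 16; 60],[:: 40; 43]);
(24,59,[:: 16; 28],[:: 32; 35]);
(24,61,[:: 8; 20],[:: 114]);
(24,62,[:: 16; 52],[:: 35; 40]);
(24,64,[:: 10; 66],[:: 46; 70]);
(24,67,[:: 8; 105],[:: 15; 17; 21]);
(24,69,[:: 8; 39; 43],[:: 15; 17; 35]);
(24,71,[:: 8; 12; 43],[:: 17; 87]);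
(24,72,[:: 16; 36; 46],[:: 43; 66]);
(24,74,[:: 16; 66],[:: 32; 82]);
(24,75,[:: 8; 39; 60],[:: 15; 17; 52]);
(24,77,[:: 8; 43; 52],[:: 17; 35; 40]);
(24,78,[:: 10; 15; 36],[:: 63; 70]);
(24,79,[:: 8; 12; 35],[:: 48; 87]);
(24,80,[:: 8; 36; 46],[:: 17; 66]);
(24,81,[:: 10; 15; 21],[:: 120]);
(24,83,[:: 8; 36; 39],[:: 15; 17; 28]);
(24,85,[:: 8; 43; 46],[:: 17; 82]);
(24,86,[:: 10; 15; 28],[:: 39; 70]);
(24,89,[:: 10; 15; 52],[:: 39; 103]);
(24,91,[:: 8; 36; 52],[:: 17; 28; 40]);
(24,92,[:: 10; 15; 29],[:: 128]);
(24,93,[:: 8; 35; 46],[:: 48; 82]);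
(24,94,[:: 15; 28; 43],[:: 16; 36; 39]);
(24,96,[:: 8; 20; 43],[:: 17; 90]);
(24,97,[:: 10; 28; 40],[:: 52; 70]);
(24,99,[:: 8; 28; 46],[:: 48; 66]);
(24,100,[:: 15; 21; 43],[:: 16; 105]);
(24,104,[:: 16; 28; 46],[:: 35; 66]);
(24,106,[:: 8; 66],[:: 32; 101]);
(24,109,[:: 8; 28; 43],[:: 17; 32; 35]);
(24,110,[:: 10; 36; 40],[:: 60; 70]);
(24,111,[:: 8; 12; 27],[:: 131]);
(24,113,[:: 15; 43; 52],[:: 16; 39; 60]);
(24,116,[:: 10; 15; 60],[:: 63; 103]);
(24,117,[:: 8; 20; 35],[:: 48; 90]);
(24,118,[:: 16; 36; 52],[:: 28; 40; 43]);
(24,121,[:: 8; 43; 66],[:: 17; 32; 82]);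
(24,124,[:: 8; 28; 43; 46],[:: 17; 35; 66]);
(24,125,[:: 10; 15; 21; 36],[:: 70; 105]);
(24,126,[:: 8; 12; 82],[:: 87; 101]);
(24,133,[:: 10; 15; 21; 60],[:: 103; 105]);
(24,134,[:: 8; 20; 82],[:: 90; 101]);
(24,137,[:: 10; 15; 105],[:: 63; 120]);
(24,138,[:: 8; 35; 66],[:: 32; 48; 82]);
(24,142,[:: 10; 15; 36; 52],[:: 39; 60; 70]);
(24,143,[:: 8; 12; 90],[:: 87; 114]);
(32,33,[:: 8; 29],[:: 25; 40]);
(32,34,[:: 15; 18],[:: 76]);
(32,41,[:: 8; 53],[:: 15; 25]);
(32,46,[:: 13; 24],[:: 66]);
(32,50,[:: 40; 44],[:: 95]);
(32,52,[:: 21; 24],[:: 28; 40]);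
(32,54,[:: 8; 21],[:: 40; 56]);
(32,55,[:: 15; 49],[:: 16; 53]);
(32,57,[:: 16; 29],[:: 40; 49]);
(32,58,[:: 15; 44],[:: 114]);
(32,60,[:: 24; 29],[:: 36; 40]);
(32,62,[:: 16; 21],[:: 40; 59]);
(32,63,[:: 15; 36],[:: 24; 53]);
(32,64,[:: 13; 70],[:: 18; 66]);
(32,65,[:: 11; 15; 21],[:: 47; 87]);
(32,67,[:: 8; 29; 47],[:: 15; 21; 25]);
(32,69,[:: 8; 43; 47],[:: 15; 109]);
(32,72,[:: 13; 16; 36],[:: 49; 66]);
(32,73,[:: 15; 21; 44],[:: 47; 95]);
(32,77,[:: 8; 21; 43],[:: 40; 109]);
(32,78,[:: 15; 18; 36],[:: 53; 70]);
(32,80,[:: 8; 13; 36],[:: 25; 66]);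
(32,81,[:: 15; 18; 21],[:: 47; 84]);
(32,83,[:: 8; 36; 47],[:: 15; 25; 28]);
(32,85,[:: 8; 13; 43],[:: 121]);
(32,86,[:: 15; 18; 28],[:: 47; 70]);
(32,88,[:: 8; 13; 49],[:: 25; 74]);
(32,91,[:: 8; 21; 36],[:: 25; 28; 40]);
(32,92,[:: 15; 18; 29],[:: 53; 84]);
(32,93,[:: 8; 13; 35],[:: 138]);
(32,94,[:: 15; 28; 49],[:: 16; 36; 47]);
(32,97,[:: 18; 28; 40],[:: 21; 70]);
(32,98,[:: 11; 15; 29],[:: 53; 87]);
(32,99,[:: 8; 13; 28],[:: 56; 66]);
(32,100,[:: 15; 21; 49],[:: 16; 29; 47]);
(32,102,[:: 8; 47; 49],[:: 15; 25; 59]);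
(32,103,[:: 24; 84],[:: 40; 70]);
(32,104,[:: 13; 16; 28],[:: 59; 66]);
(32,105,[:: 15; 21; 36],[:: 24; 29; 47]);
(32,108,[:: 15; 70],[:: 24; 76]);
(32,110,[:: 18; 36; 40],[:: 29; 70]);
(32,111,[:: 11; 15; 37],[:: 143]);
(32,112,[:: 8; 13; 59],[:: 56; 74]);
(32,115,[:: 8; 21; 49],[:: 25; 40; 59]);
(32,118,[:: 16; 21; 36],[:: 28; 40; 49]);
(32,119,[:: 15; 29; 44],[:: 53; 95]);
(32,120,[:: 15; 21; 70],[:: 24; 47; 84]);
(32,123,[:: 11; 15; 84],[:: 76; 87]);
(32,124,[:: 8; 13; 28; 43],[:: 66; 109]);
(32,125,[:: 15; 18; 21; 36],[:: 29; 47; 70]);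
(32,128,[:: 15; 29; 70],[:: 24; 53; 84]);
(32,129,[:: 8; 13; 109],[:: 56; 121]);
(32,131,[:: 11; 15; 95],[:: 87; 114]);
(32,132,[:: 8; 13; 28; 49],[:: 25; 59; 66]);
(32,140,[:: 15; 44; 84],[:: 76; 95]);
(32,141,[:: 8; 13; 43; 59],[:: 74; 109]);
(40,41,[:: 8; 22],[:: 15; 33]);
(40,51,[:: 15; 45],[:: 74]);
(40,53,[:: 15; 29],[:: 22; 32]);
(40,55,[:: 15; 57],[:: 16; 22]);
(40,58,[:: 15; 50],[:: 101]);
(40,61,[:: 15; 37],[:: 106]);
(40,63,[:: 15; 60],[:: 22; 24]);
(40,65,[:: 14; 87],[:: 15; 19; 21]);
(40,67,[:: 8; 14; 29],[:: 15; 21; 33]);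
(40,69,[:: 8; 14; 43],[:: 15; 77]);
(40,73,[:: 14; 95],[:: 15; 21; 50]);
(40,75,[:: 8; 14; 60],[:: 15; 33; 52]);
(40,76,[:: 15; 84],[:: 32; 68]);
(40,78,[:: 15; 110],[:: 22; 70]);
(40,81,[:: 14; 84],[:: 15; 21; 26]);
(40,83,[:: 8; 14; 36],[:: 15; 91]);
(40,86,[:: 14; 70],[:: 15; 97]);
(40,89,[:: 14; 103],[:: 15; 26; 52]);
(40,90,[:: 15; 87],[:: 32; 82]);
(40,92,[:: 15; 26; 29],[:: 22; 84]);
(40,94,[:: 14; 16; 36],[:: 15; 118]);
(40,96,[:: 15; 71],[:: 121]);
(40,98,[:: 15; 19; 29],[:: 22; 87]);
(40,100,[:: 14; 16; 29],[:: 15; 21; 57]);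
(40,102,[:: 8; 14; 49],[:: 15; 115]);
(40,105,[:: 14; 24; 29],[:: 15; 21; 60]);
(40,107,[:: 8; 14; 57],[:: 15; 33; 62]);
(40,108,[:: 15; 103],[:: 24; 68]);
(40,111,[:: 15; 19; 37],[:: 126]);
(40,113,[:: 14; 16; 60],[:: 15; 52; 57]);
(40,114,[:: 15; 95],[:: 32; 101]);
(40,116,[:: 15; 26; 60],[:: 22; 103]);
(40,117,[:: 15; 79],[:: 138]);
(40,119,[:: 15; 29; 50],[:: 22; 95]);
(40,120,[:: 14; 24; 84],[:: 15; 21; 103]);
(40,122,[:: 8; 14; 110],[:: 15; 33; 97]);
(40,123,[:: 15; 19; 84],[:: 68; 87]);
(40,125,[:: 14; 29; 70],[:: 15; 21; 110]);
(40,127,[:: 8; 14; 72],[:: 15; 136]);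
(40,128,[:: 15; 29; 103],[:: 22; 24; 84]);
(40,130,[:: 14; 16; 110],[:: 15; 57; 97]);
(40,131,[:: 15; 19; 95],[:: 87; 101]);
(40,133,[:: 14; 29; 103],[:: 15; 21; 26; 60]);
(40,134,[:: 15; 126],[:: 82; 106]);
(40,135,[:: 8; 14; 118],[:: 15; 62; 91]);
(40,139,[:: 8; 14; 36; 57],[:: 15; 33; 118]);
(40,140,[:: 15; 50; 84],[:: 68; 95]);
(40,142,[:: 14; 60; 70],[:: 15; 52; 110]);
(40,143,[:: 15; 37; 87],[:: 32; 126]);
(48,51,[:: 20; 42],[:: 117]);
(48,59,[:: 28; 42],[:: 35; 56]);
(48,60,[:: 17; 52],[:: 24; 50]);
(48,62,[:: 35; 54],[:: 42; 52]);
(48,63,[:: 17; 39],[:: 24; 58]);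
(48,64,[:: 10; 99],[:: 42; 44; 46]);
(48,67,[:: 8; 73],[:: 17; 21; 23]);
(48,68,[:: 8; 10; 14],[:: 42; 101]);
(48,69,[:: 8; 10; 39],[:: 17; 23; 35]);
(48,70,[:: 8; 10; 28],[:: 24; 42; 44]);
(48,71,[:: 8; 10; 12],[:: 17; 79]);
(48,74,[:: 42; 66],[:: 138]);
(48,75,[:: 8; 39; 50],[:: 17; 23; 52]);
(48,76,[:: 8; 10; 47],[:: 42; 114]);
(48,77,[:: 8; 10; 52],[:: 17; 35; 54]);
(48,80,[:: 8; 44; 46],[:: 17; 99]);
(48,81,[:: 10; 21; 23],[:: 42; 73]);
(48,83,[:: 8; 39; 44],[:: 17; 23; 28]);
(48,84,[:: 8; 10; 21],[:: 42; 95]);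
(48,85,[:: 8; 10; 46],[:: 17; 93]);
(48,86,[:: 10; 23; 28],[:: 39; 42; 44]);
(48,89,[:: 10; 23; 52],[:: 39; 42; 50]);
(48,91,[:: 8; 44; 52],[:: 17; 28; 54]);
(48,96,[:: 8; 10; 20],[:: 17; 117]);
(48,97,[:: 10; 28; 54],[:: 42; 44; 52]);
(48,98,[:: 17; 65],[:: 131]);
(48,103,[:: 8; 10; 52],[:: 24; 42; 50]);
(48,104,[:: 28; 42; 46],[:: 35; 99]);
(48,105,[:: 17; 21; 39],[:: 24; 73]);
(48,108,[:: 8; 10; 39],[:: 24; 42; 58]);
(48,109,[:: 8; 10; 28],[:: 17; 35; 56]);
(48,112,[:: 42; 99],[:: 56; 93]);
(48,119,[:: 17; 73],[:: 58; 95]);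
(48,120,[:: 8; 10; 21; 39],[:: 24; 42; 73]);
(48,121,[:: 8; 10; 66],[:: 17; 138]);
(48,123,[:: 8; 10; 65],[:: 42; 131]);
(48,124,[:: 8; 10; 28; 46],[:: 17; 35; 99]);
(48,129,[:: 8; 10; 99],[:: 17; 56; 93]);
(48,140,[:: 8; 10; 73],[:: 42; 58; 95]);
(56,58,[:: 23; 44],[:: 48; 61]);
(56,64,[:: 13; 42; 44],[:: 18; 99]);
(56,65,[:: 11; 21; 23],[:: 47; 79]);
(56,67,[:: 8; 37; 47],[:: 21; 23; 25]);
(56,68,[:: 8; 14; 18],[:: 42; 106]);
(56,69,[:: 8; 10; 47],[:: 23; 109]);
(56,70,[:: 8; 18; 28],[:: 32; 42; 44]);
(56,73,[:: 21; 23; 44],[:: 37; 47; 48]);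
(56,76,[:: 8; 18; 47],[:: 32; 42; 61]);
(56,77,[:: 8; 10; 21],[:: 54; 109]);
(56,80,[:: 8; 13; 44],[:: 25; 99]);
(56,81,[:: 18; 21; 23],[:: 37; 42; 47]);
(56,82,[:: 8; 11; 14],[:: 138]);
(56,83,[:: 8; 44; 47],[:: 23; 25; 28]);
(56,84,[:: 8; 18; 21],[:: 32; 37; 42]);
(56,85,[:: 8; 10; 13],[:: 129]);
(56,86,[:: 18; 23; 28],[:: 42; 44; 47]);
(56,87,[:: 8; 11; 21],[:: 32; 79]);
(56,88,[:: 8; 13; 18],[:: 25; 112]);
(56,90,[:: 8; 11; 47],[:: 32; 117]);
(56,91,[:: 8; 21; 44],[:: 25; 28; 54]);
(56,95,[:: 8; 21; 44],[:: 32; 37; 48]);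
(56,97,[:: 18; 28; 54],[:: 21; 42; 44]);
(56,101,[:: 8; 14; 44],[:: 48; 106]);
(56,102,[:: 8; 18; 47],[:: 23; 25; 59]);
(56,104,[:: 13; 28; 42],[:: 59; 99]);
(56,111,[:: 11; 23; 37],[:: 61; 79]);
(56,114,[:: 8; 44; 47],[:: 32; 48; 61]);
(56,115,[:: 8; 18; 21],[:: 25; 54; 59]);
(56,124,[:: 8; 10; 13; 28],[:: 99; 109]);
(56,126,[:: 8; 11; 14; 37],[:: 79; 106]);
(56,132,[:: 8; 13; 18; 28],[:: 25; 59; 99]);
(56,134,[:: 8; 11; 14; 61],[:: 106; 117]);
(56,141,[:: 8; 10; 13; 59],[:: 109; 112]);
(56,143,[:: 8; 11; 37; 47],[:: 32; 61; 79]);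
(64,67,[:: 12; 14; 18; 41],[:: 13; 122]);
(64,74,[:: 11; 13; 68],[:: 18; 38; 66]);
(64,75,[:: 10; 12; 14; 41],[:: 46; 122]);
(64,76,[:: 13; 34; 70],[:: 18; 20; 68]);
(64,77,[:: 9; 11; 46; 54],[:: 10; 136]);
(64,81,[:: 12; 14; 18; 34],[:: 13; 26; 86]);
(64,82,[:: 10; 38; 66],[:: 11; 46; 68]);
(64,84,[:: 12; 18; 68],[:: 13; 26; 70]);
(64,85,[:: 9; 11; 30; 46],[:: 10; 38; 80]);
(64,88,[:: 9; 11; 13; 30],[:: 18; 38; 80]);
(64,89,[:: 10; 12; 14; 34],[:: 26; 46; 86]);
(64,92,[:: 12; 18; 22; 34],[:: 13; 26; 78]);
(64,93,[:: 10; 38; 99],[:: 11; 30; 42; 46]);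
(64,100,[:: 12; 14; 18; 55],[:: 13; 130]);
(64,101,[:: 10; 30; 66],[:: 44; 46; 68]);
(64,102,[:: 9; 11; 13; 23],[:: 18; 127]);
(64,103,[:: 10; 12; 68],[:: 26; 46; 70]);
(64,106,[:: 13; 44; 68],[:: 18; 30; 66]);
(64,108,[:: 10; 20; 68],[:: 34; 46; 70]);
(64,112,[:: 11; 13; 30; 42],[:: 18; 38; 99]);
(64,113,[:: 10; 12; 14; 55],[:: 46; 130]);
(64,115,[:: 9; 11; 13; 54],[:: 18; 136]);
(64,116,[:: 10; 12; 22; 34],[:: 26; 46; 78]);
(64,124,[:: 9; 11; 46; 99],[:: 10; 80; 104]);
(64,125,[:: 12; 14; 18; 78],[:: 13; 86; 110]);
(64,132,[:: 9; 11; 13; 99],[:: 18; 80; 104]);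
(64,142,[:: 10; 12; 14; 78],[:: 46; 86; 110]);
(72,74,[:: 11; 13; 16; 22],[:: 38; 49; 66]);
(72,75,[:: 12; 14; 41; 43],[:: 46; 139]);
(72,82,[:: 11; 16; 22; 46],[:: 38; 43; 66]);
(72,85,[:: 9; 11; 22; 46],[:: 38; 43; 80]);
(72,86,[:: 9; 11; 14; 20],[:: 64; 94]);
(72,88,[:: 9; 11; 13; 22],[:: 38; 49; 80]);
(72,97,[:: 9; 11; 12; 14],[:: 64; 118]);
(72,99,[:: 64; 66],[:: 80; 104]);
(72,100,[:: 12; 14; 49; 55],[:: 13; 57; 94]);
(72,102,[:: 9; 11; 13; 15],[:: 49; 127]);
(72,110,[:: 9; 11; 12; 22],[:: 36; 57; 64]);
(72,113,[:: 12; 14; 43; 55],[:: 46; 57; 94]);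
(72,115,[:: 9; 11; 13; 40],[:: 49; 136]);
(72,122,[:: 9; 11; 12; 14; 41],[:: 64; 139]);
(72,124,[:: 9; 11; 46; 66],[:: 43; 80; 104]);
(72,130,[:: 9; 11; 12; 14; 55],[:: 57; 64; 94]);
(72,132,[:: 9; 11; 13; 66],[:: 49; 80; 104]);
(80,82,[:: 8; 11; 22; 46],[:: 66; 85]);
(80,93,[:: 8; 11; 30; 46],[:: 85; 99]);
(80,94,[:: 9; 14; 20; 36],[:: 72; 83]);
(80,96,[:: 11; 13; 17; 41],[:: 20; 25; 85]);
(80,97,[:: 9; 12; 14; 44],[:: 64; 91]);
(80,101,[:: 8; 22; 44; 46],[:: 17; 30; 66]);
(80,106,[:: 8; 13; 22; 44],[:: 25; 30; 66]);
(80,107,[:: 9; 12; 14; 41],[:: 33; 127]);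
(80,109,[:: 8; 11; 13; 17],[:: 25; 124]);
(80,110,[:: 9; 12; 22; 44],[:: 33; 36; 64]);
(80,112,[:: 8; 11; 13; 30],[:: 88; 99]);
(80,118,[:: 9; 12; 14; 36],[:: 72; 91]);
(80,121,[:: 8; 11; 13; 17; 22],[:: 25; 66; 85]);
(80,122,[:: 9; 12; 14; 41; 44],[:: 33; 64; 83]);
(80,129,[:: 8; 11; 13; 17; 30],[:: 25; 85; 99]);
(80,135,[:: 9; 12; 14; 83],[:: 91; 127]);
(80,139,[:: 9; 12; 14; 36; 41],[:: 33; 72; 83]);
(80,141,[:: 8; 11; 13; 85],[:: 88; 124]);
(88,91,[:: 11; 14; 25; 33],[:: 80; 115]);
(88,96,[:: 9; 11; 13; 41],[:: 25; 51; 85]);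
(88,104,[:: 9; 11; 13; 14],[:: 38; 132]);
(88,106,[:: 8; 13; 18; 22],[:: 25; 30; 74]);
(88,107,[:: 9; 14; 41; 45],[:: 33; 38; 102]);
(88,109,[:: 8; 9; 11; 13],[:: 25; 141]);
(88,121,[:: 8; 9; 11; 13; 22],[:: 25; 74; 85]);
(88,127,[:: 9; 11; 13; 14; 41],[:: 38; 80; 102]);
(88,129,[:: 8; 9; 11; 13; 30],[:: 25; 85; 112]);
(88,136,[:: 9; 11; 13; 14; 33],[:: 38; 80; 115]);
(96,98,[:: 11; 13; 41; 43],[:: 27; 53; 71]);
(96,99,[:: 11; 13; 17; 23],[:: 20; 129]);
(96,111,[:: 10; 11; 13; 41],[:: 27; 61; 71]);
(96,112,[:: 9; 11; 13; 23],[:: 51; 129]);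
(96,114,[:: 8; 10; 20; 53],[:: 17; 61; 90]);
(96,124,[:: 11; 13; 17; 69],[:: 20; 85; 109]);
(96,126,[:: 8; 10; 11; 13; 22],[:: 71; 134]);
(96,141,[:: 9; 11; 13; 69],[:: 51; 85; 109]);
(96,143,[:: 8; 10; 11; 13; 53],[:: 61; 71; 90]);
(104,107,[:: 8; 12; 31; 38],[:: 62; 127]);
(104,112,[:: 11; 13; 14; 42],[:: 38; 59; 99]);
(104,118,[:: 11; 12; 14; 16],[:: 28; 62; 72]);
(104,135,[:: 8; 11; 12; 14; 31],[:: 28; 62; 127]);
(104,141,[:: 9; 11; 13; 14; 35],[:: 38; 59; 124]);
(112,115,[:: 8; 14; 18; 45],[:: 54; 59; 88]);
(112,121,[:: 8; 9; 11; 13; 14],[:: 74; 129]);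
(112,124,[:: 8; 10; 11; 13; 14],[:: 99; 141]);
(112,132,[:: 8; 11; 13; 14; 18],[:: 59; 88; 99]);
(112,138,[:: 8; 11; 13; 14; 42],[:: 56; 74; 93]);
(120,123,[:: 10; 12; 13; 15; 16; 42],[:: 65; 84; 108]);
(120,133,[:: 9; 10; 12; 14; 15; 21],[:: 81; 103; 105]);
(120,140,[:: 8; 10; 12; 13; 15; 42],[:: 73; 84; 108]);
(128,137,[:: 9; 10; 12; 13; 15; 15],[:: 63; 92; 120]);
(128,140,[:: 8; 9; 10; 12; 13; 15],[:: 84; 108; 119])]%positive.

Definition initial_seed : combinatorial_seed := [::
(46, ([:: 14; 20], [:: 13; 39]));
(39, ([:: 31; 46], [:: 14; 27]));
(31, ([:: 15; 35], [:: 16; 39]));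
(16, ([:: 8; 31], [:: 15; 42]));
(20, ([:: 12; 27], [:: 11; 46]));
(27, ([:: 11; 39], [:: 20; 35]));
(35, ([:: 27; 42], [:: 10; 31]));
(42, ([:: 10; 16], [:: 9; 35]))]%positive.

Definition exchange_table : exchanges :=
  foldr (fun (r : relation) T =>
    let: (z, z', p, n) := r in
    foldr (fun k T =>
      let c := rotate_column k (p, n) in
      add_exchange (rotate k z) (rotate k z') c
        (add_exchange (rotate k z') (rotate k z) c T)) T (iota 0 8))
    (PositiveMap.empty _) relations.

(** * Multiplicities under combinatorial mutation *)

Lemma rotateD (k l : nat) (x : positive) : rotate (k + l) x = rotate k (rotate l x).
Proof. exact: iterD. Qed.

(** Rotating eight times is the identity, also on numbers that name nothing, so
    that no side condition is needed to invert a rotation. *)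
Lemma rotate8 (x : positive) : rotate 8 x = x.
Proof. by case: x => [[[x|x|]|[x|x|]|]|[[x|x|]|[x|x|]|]|]. Qed.

Lemma rotate_mul8 (k : nat) (x : positive) : rotate (8 * k) x = x.
Proof. by elim: k => [|k IH] //; rewrite mulnS rotateD IH rotate8. Qed.

Lemma rotateK (k : nat) : cancel (rotate k) (rotate (7 * k)).
Proof. by move=> x; rewrite -rotateD -mulSnr rotate_mul8. Qed.

Lemma rotate_inj (k : nat) : injective (rotate k).
Proof. exact: can_inj (rotateK k). Qed.

Lemma is_cluster_id_rotate (k : nat) (x : positive) :
  is_cluster_id (rotate k x) = is_cluster_id x.
Proof.
rewrite /is_cluster_id; suff -> : orbit_number (rotate k x) = orbit_number x by [].
elim: k => //= k <-; move: (rotate k x) => y.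
by case: y => [[[y|y|]|[y|y|]|]|[[y|y|]|[y|y|]|]|].
Qed.

Lemma id_rangeP (a n : nat) (x : positive) :
  reflect (exists2 i, (a <= i < a + n)%N & x = Pos.of_nat i) (x \in id_range a n).
Proof.
by apply: (iffP mapP) => -[i ia ->]; exists i; rewrite // ?mem_iota // -mem_iota.
Qed.

Lemma mem_cluster_ids x : is_cluster_id x -> x \in cluster_ids.
Proof.
rewrite /is_cluster_id => /andP[/Pos.leb_le h /Pos.ltb_lt h'].
apply/id_rangeP; exists (Pos.to_nat x); last by rewrite Pos2Nat.id.
move: h h'; rewrite /orbit_number.
by case: (x) => [[[q|q|]|[q|q|]|]|[[q|q|]|[q|q|]|]|] //=; lia.
Qed.

Lemma count_mem_cancel_common (x : positive) (p n : seq positive) :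
  (count_mem x (cancel_common p n).1 = count_mem x p - count_mem x n)%N /\
  (count_mem x (cancel_common p n).2 = count_mem x n - count_mem x p)%N.
Proof.
elim: p n => [|y p IH] n /=; first by rewrite sub0n subn0.
case: ifP => yn.
  have [-> ->] := IH (rem y n); rewrite count_mem_rem (eq_sym y x).
  case: eqP => [xy|_]; last by rewrite subn0 add0n.
  have : (0 < count_mem x n)%N by rewrite -has_count has_pred1 xy.
  by rewrite add1n subn1; move: (count_mem x n) (count_mem x p) => u v; lia.
have := IH n; case: (cancel_common p n) => p' n' /= [-> ->].
case: eqP => // <-; have -> : count_mem y n = 0%N by apply/count_memPn; rewrite yn.
by split; lia.
Qed.

Lemma count_mem_mutate_parts (x z z' : positive) (a b : nat) (p q : seq positive) :
  count_mem x (filter (predC1 z) p ++ flatten (nseq a q) ++ nseq b z') =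
  ((x != z) * count_mem x p + (a * count_mem x q + (x == z') * b))%N.
Proof.
rewrite !count_cat count_flatten map_nseq sumn_nseq count_nseq mulnC /=.
congr (_ + (_ + _))%N; last by rewrite eq_sym.
rewrite count_filter; case: eqP => [->|/eqP xz] /=.
  rewrite mul0n; apply/eqP; rewrite -leqn0 leqNgt -has_count; apply/hasP.
  by move=> [y _ /= /andP[/eqP-> /eqP]].
rewrite mul1n; apply: eq_count => y /=; case: eqP => // ->.
by rewrite xz.
Qed.

Definition disjoint_column (c : column) : Prop :=
  forall x, x \in c.1 -> x \notin c.2.

Lemma disjoint_column_count (c : column) : disjoint_column c ->
  forall x, count_mem x c.1 = 0%N \/ count_mem x c.2 = 0%N.
Proof.
move=> d x; case xc : (x \in c.1).
  by right; apply/count_memPn/d.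
by left; apply/count_memPn; rewrite xc.
Qed.

Section MutateColumn.
Variables (z z' : positive) (cz c : column).
Let a := count_mem z c.1.
Let b := count_mem z c.2.

(** Both multiplicities are those of the uncancelled monomials up to the same
    number d of cancelled factors, so their difference is known exactly. *)
Lemma mutate_column_count (x : positive) : x != z ->
  exists d : nat,
  ((count_mem x (mutate_column z z' cz c).1 + d =
     count_mem x c.1 + a * count_mem x cz.1 + (x == z') * b) /\
  (count_mem x (mutate_column z z' cz c).2 + d =
     count_mem x c.2 + b * count_mem x cz.2 + (x == z') * a))%N.
Proof.
rewrite /a /b; case: c => p n /= xz; case: ifP => [/andP[/eqP -> /eqP ->]|_].
  by exists 0%N => /=; lia.
have [-> ->] := count_mem_cancel_common x
  (filter (predC1 z) p ++ flatten (nseq (count_mem z p) cz.1) ++ nseq (count_mem z n) z')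
  (filter (predC1 z) n ++ flatten (nseq (count_mem z n) cz.2) ++ nseq (count_mem z p) z').
rewrite !count_mem_mutate_parts xz !mul1n.
set u := (count_mem x p + _)%N; set v := (count_mem x n + _)%N.
by exists (minn u v); rewrite -!addnA -/u -/v; move: u v => u v; split; lia.
Qed.

Lemma mutate_column_disjoint :
  disjoint_column c -> disjoint_column (mutate_column z z' cz c).
Proof.
rewrite /mutate_column; case: c => p n /= d.
case: ifP => // _; set u := _ ++ _; set v := _ ++ _ => x.
have [h1 h2] := count_mem_cancel_common x u v.
rewrite -!has_pred1 !has_count h1 h2.
by move: (count_mem x u) (count_mem x v) => m k; lia.
Qed.

Lemma mutate_column_support (x : positive) :
  z \notin cz.1 -> z \notin cz.2 ->
  x \in (mutate_column z z' cz c).1 ++ (mutate_column z z' cz c).2 ->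
  [|| (x != z) && (x \in c.1 ++ c.2), (x != z) && (x \in cz.1 ++ cz.2) | x == z'].
Proof.
move=> /count_memPn z1 /count_memPn z2.
rewrite /mutate_column; case: c => p n /=.
case: ifP => [/andP[/eqP zp /eqP zn] |_].
  case: (x =P z) => [->|_ ->] //=.
  by rewrite mem_cat -!has_pred1 !has_count zp zn.
set u := _ ++ _ ++ _; set v := filter _ n ++ _ ++ _.
have [h1 h2] := count_mem_cancel_common x u v.
rewrite !mem_cat -!(has_pred1 x) !has_count h1 h2 !count_mem_mutate_parts /=.
by case: (x =P z) z1 z2 => [->|_] /=; case: (_ =P z') => //=; lia.
Qed.

End MutateColumn.

Lemma count_mem_rotate (k : nat) (x : positive) (p : seq positive) :
  count_mem (rotate k x) (sort Pos.leb (map (rotate k) p)) = count_mem x p.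
Proof.
rewrite (seq.permP (permEl (perm_sort _ _))) count_map; apply: eq_count => y /=.
by rewrite (inj_eq (@rotate_inj k)).
Qed.

Lemma mem_rotate (k : nat) (x : positive) (p : seq positive) :
  x \in sort Pos.leb (map (rotate k) p) -> exists2 y, y \in p & x = rotate k y.
Proof. by rewrite mem_sort => /mapP. Qed.

Lemma mem_rotate_rotate (k : nat) (x : positive) (p : seq positive) :
  (rotate k x \in sort Pos.leb (map (rotate k) p)) = (x \in p).
Proof. by rewrite mem_sort mem_map //; exact: rotate_inj. Qed.

(** * Seeds realized by combinatorial seeds *)

Definition exchange_entry (x : positive) (c : column) : int :=
  (count_mem x c.1)%:Z - (count_mem x c.2)%:Z.

(** The rule of matrix mutation in terms of multiplicities: u and v are those of
    the row in the column z, a and b those of the row z in the column mutated. *)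
Lemma mutate_entry (u v m w a b d p n : nat) :
  u = 0%N \/ v = 0%N -> a = 0%N \/ b = 0%N ->
  (p + d = m + a * u)%N -> (n + d = w + b * v)%N ->
  p%:Z - n%:Z = (m%:Z - w%:Z) +
    ((`|u%:Z - v%:Z| * (a%:Z - b%:Z) + (u%:Z - v%:Z) * `|a%:Z - b%:Z|) %/ 2)%Z.
Proof.
move=> uv ab h1 h2.
have -> : `|u%:Z - v%:Z| * (a%:Z - b%:Z) + (u%:Z - v%:Z) * `|a%:Z - b%:Z| =
          ((a * u)%:Z - (b * v)%:Z) * 2.
  rewrite !PoszM; case: uv => ->; case: ab => ->;
  rewrite ?mulr0 ?subr0 ?sub0r ?normrN ?(ger0_norm (ler0n _ _)) //; ring.
by rewrite mulzK //; lia.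
Qed.

Section Realization.
Variables (F : fieldType) (I J : finType) (val : positive -> F).

Definition monomial_value (k : nat) (p : seq positive) : F :=
  \prod_(x <- p) val (rotate k x).

(** The relation is required along the whole rotation orbit because a seed may be
    tracked through a rotated copy of it. *)
Definition valid_exchange (z z' : positive) (c : column) : Prop :=
  [/\ is_cluster_id z', z \notin c.1, z \notin c.2 &
      forall k, val (rotate k z) * val (rotate k z') =
                monomial_value k c.1 + monomial_value k c.2].

Definition valid_exchanges (T : exchanges) : Prop :=
  forall z z' c, (z', c) \in exchanges_of T z -> valid_exchange z z' c.

Hypothesis val_neq0 : forall x, is_cluster_id x -> val x != 0.

(** The seed [s] is the combinatorial seed [a] rotated k times: [lab] names its
    rows and [col] gives its columns before the rotation. *)
Record realizes (s : seed_data F I J) (a : combinatorial_seed) (k : nat)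
    (lab : I + J -> positive) (col : I -> column) : Prop := Realizes {
  label_inj : injective lab;
  label_cluster : forall i, is_cluster_id (lab (inl i));
  label_coefficient : forall j, ~~ is_cluster_id (lab (inr j));
  label_value : forall r, extended_cluster s r = val (rotate k (lab r));
  column_exchange : forall i r, exchange s r i = exchange_entry (lab r) (col i);
  column_disjoint : forall i, disjoint_column (col i);
  column_support : forall i x, x \in (col i).1 ++ (col i).2 -> exists r, x = lab r;
  seed_entries : forall e, e \in a <-> exists i, e = (lab (inl i), col i) }.

(** Rotating the names by n is compensated by n rotations backwards, that is 7 n
    rotations forwards. *)
Lemma realizes_rotate s a k lab col n :
  realizes s a k lab col ->
  realizes s (rotate_seed n a) (k + 7 * n) (fun r => rotate n (lab r))
    (fun i => rotate_column n (col i)).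
Proof.
case=> inj clus coef vals exch disj supp ent; split.
- by move=> r r' /rotate_inj/inj.
- by move=> i; rewrite is_cluster_id_rotate.
- by move=> j; rewrite is_cluster_id_rotate.
- by move=> r; rewrite vals rotateD rotateK.
- by move=> i r; rewrite exch /exchange_entry !count_mem_rotate.
- move=> i x /mem_rotate[y yi ->]; rewrite mem_rotate_rotate.
  exact: disj.
- move=> i x; rewrite mem_cat => /orP[] /mem_rotate[y yi ->];
  by have [|r ->] := supp i y; [rewrite mem_cat yi ?orbT|exists r].
- move=> e; rewrite /rotate_seed mem_sort; split.
    by move=> /mapP[_ /ent[i ->] ->]; exists i.
  by move=> [i ->]; apply/mapP; exists (lab (inl i), col i); first by apply/ent; exists i.
Qed.

(** Turns the products in [exchange_numerator] into products over lists of names. *)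
Lemma monomial_value_labels k (lab : I + J -> positive) (p : seq positive) :
  injective lab -> (forall x, x \in p -> exists r, x = lab r) ->
  \prod_r val (rotate k (lab r)) ^+ count_mem (lab r) p = monomial_value k p.
Proof.
move=> inj; rewrite /monomial_value; elim: p => [|x p IH] h.
  by rewrite big_nil big1 // => r _; rewrite expr0.
rewrite big_cons -IH; last by move=> y yp; apply: h; rewrite inE yp orbT.
under eq_bigr => r _ do rewrite /= exprD.
rewrite big_split /=; congr (_ * _).
have [r ->] := h x (mem_head _ _).
rewrite (bigD1 r) //= eqxx expr1 big1 ?mulr1 // => r' /negbTE rr'.
by rewrite (inj_eq inj) eq_sym rr'.
Qed.

Lemma realizes_numerator s a k lab col i :
  realizes s a k lab col ->
  exchange_numerator s i =
    monomial_value k (col i).1 + monomial_value k (col i).2.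
Proof.
case=> inj _ _ vals exch disj supp _; rewrite /exchange_numerator.
have d := disjoint_column_count (disj i).
have sup1 x : x \in (col i).1 -> exists r, x = lab r.
  by move=> xi; apply: (supp i); rewrite mem_cat xi.
have sup2 x : x \in (col i).2 -> exists r, x = lab r.
  by move=> xi; apply: (supp i); rewrite mem_cat xi orbT.
rewrite -!(monomial_value_labels k inj) //; congr (_ + _).
  rewrite big_mkcond; apply: eq_bigr => r _; rewrite exch vals /exchange_entry.
  case: (d (lab r)) => ->.
    by rewrite sub0r oppr_gt0 ltNge lez_nat leq0n.
  by rewrite subr0 ltz_nat; case: (count_mem _ _).
rewrite big_mkcond; apply: eq_bigr => r _; rewrite exch vals /exchange_entry.
case: (d (lab r)) => ->.
  by rewrite sub0r oppr_lt0 ltz_nat abszN; case: (count_mem _ _).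
by rewrite subr0 ltNge lez_nat leq0n.
Qed.

Lemma monomial_value_sort k p : monomial_value k (sort Pos.leb p) = monomial_value k p.
Proof. by apply: perm_big; exact: permEl (perm_sort _ _). Qed.

Lemma exchange_partnerP T z z' c : valid_exchanges T ->
  exchange_partner T z (sort Pos.leb c.1, sort Pos.leb c.2) = Some z' ->
  valid_exchange z z' c.
Proof.
move=> valT; rewrite /exchange_partner.
case E : [seq _ <- _ | _] => [|[y d] l] //= [yz'].
have : (y, d) \in [seq e <- exchanges_of T z |
   (e.2 == (sort Pos.leb c.1, sort Pos.leb c.2)) ||
   (e.2 == opposite (sort Pos.leb c.1, sort Pos.leb c.2))] by rewrite E mem_head.
rewrite mem_filter /= yz' => /andP[/orP[]/eqP dc /valT [z'c]]; rewrite dc /= !mem_sort;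
  move=> z1 z2 ex; split=> // k; rewrite ex !monomial_value_sort //.
by rewrite addrC.
Qed.

(** The new variable is the value of the partner z' because the exchange relation
    of z holds for the named functions and the value of z is nonzero. The name z'
    is new: it is not the name of a coefficient, and [mutate_seed] checks that it
    does not occur in the seed. This is what makes the new labelling injective. *)
Lemma realizes_mutate T s a k lab col i a' :
  valid_exchanges T -> realizes s a k lab col ->
  mutate_seed T (lab (inl i)) (col i) a = Some a' ->
  exists lab' col', realizes (mutate i s) a' k lab' col'.
Proof.
move=> valT real; rewrite /mutate_seed; set z := lab (inl i).
case E : exchange_partner => [z'|] //; case: ifP => // /negbT z'a [<-].
have [z'clus z1 z2 ex] := exchange_partnerP valT E.
have num := realizes_numerator i real.
case: real => inj clus coef vals exch disj supp ent.
have z'lab r : z' != lab r.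
  apply/eqP => z'r; case: r z'r => [j|j] z'r; last by have := coef j; rewrite -z'r z'clus.
  move/negP: z'a; apply; rewrite z'r; apply/mapP; exists (lab (inl j), col j) => //.
  by apply/ent; exists j.
have zz' : z' != z by exact: z'lab.
have fresh q : (exists j, q = (col j).1 \/ q = (col j).2) -> count_mem z' q = 0%N.
  move=> [j h]; apply/count_memPn/negP => z'p; have [|r'] := supp j z'.
    by rewrite mem_cat; case: h => <-; rewrite z'p ?orbT.
  by move=> z'r'; have := z'lab r'; rewrite z'r' eqxx.
have labz r : (lab r == z) = (r == inl i) by rewrite (inj_eq inj).
pose lab' r := if r == inl i then z' else lab r.
pose col' j := if j == i then opposite (col i) else mutate_column z z' (col i) (col j).
exists lab', col'; split.
- move=> r r'; rewrite /lab'; case: eqP => [->|_]; case: eqP => [->|_] //.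
  + by move=> h; have := z'lab r'; rewrite h eqxx.
  + by move=> h; have := z'lab r; rewrite h eqxx.
  + exact: inj.
- by move=> j; rewrite /lab'; case: eqP.
- by move=> j; rewrite /lab' /=.
- move=> r; case: r => [j|j] /=; last by rewrite /lab' /= -(vals (inr j)).
  rewrite /lab' (_ : (inl j == inl i :> I + J) = (j == i)) //.
  case: eqP => _; last by rewrite -(vals (inl j)).
  rewrite num -ex (vals (inl i) : cluster s i = _) -/z mulrC mulKf //.
  by apply: val_neq0; rewrite is_cluster_id_rotate; exact: clus.
- move=> j r; rewrite /= /lab' /col'.
  case: (j =P i) => [->|ji].
    rewrite orbT exch; case: eqP => [->|_]; last by rewrite /exchange_entry opprB.
    rewrite /exchange_entry /= -/z (count_memPn z1) (count_memPn z2).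
    by rewrite !fresh ?subrr ?oppr0 //; exists i; [left|right].
  rewrite orbF; have dj := disjoint_column_count (disj j).
  have di := disjoint_column_count (disj i).
  case: eqP => [->|/eqP ri].
    have [d []] := mutate_column_count z' (col i) (col j) zz'.
    have [f1 f2 f3 f4] : [/\ count_mem z' (col j).1 = 0, count_mem z' (col j).2 = 0,
                          count_mem z' (col i).1 = 0 & count_mem z' (col i).2 = 0]%N.
      by split; apply: fresh; [exists j; left|exists j; right|exists i; left|exists i; right].
    rewrite eqxx f1 f2 f3 f4 !muln0 !mul1n !add0n.
    rewrite exch /exchange_entry -/z.
    by move: (count_mem _ _) (count_mem _ _) (count_mem _ _) (count_mem _ _); lia.
  have rz : lab r != z by rewrite labz.
  have [d []] := mutate_column_count z' (col i) (col j) rz.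
  rewrite (eq_sym _ z') (negbTE (z'lab r)) !exch -/z !mul0n !addn0.
  by move=> h1 h2; apply/esym; exact: mutate_entry (di _) (dj _) h1 h2.
- move=> j; rewrite /col'; case: eqP => _; last exact: mutate_column_disjoint.
  by move=> x /= x2; apply/negP => x1; move/negP: (disj i x x1).
- move=> j x; rewrite /col'; case: eqP => _.
    rewrite mem_cat orbC -mem_cat => xi; have [r xr] := supp i x xi.
    exists r; rewrite /lab'; case: eqP => // ri; move: xi.
    by rewrite xr ri -/z mem_cat (negbTE z1) (negbTE z2).
  move=> /(mutate_column_support z1 z2)/or3P[/andP[xz]|/andP[xz]|/eqP->].
  + move/supp => [r xr]; exists r; rewrite /lab'; case: eqP => // ri.
    by move: xz; rewrite xr ri eqxx.
  + move/supp => [r xr]; exists r; rewrite /lab'; case: eqP => // ri.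
    by move: xz; rewrite xr ri eqxx.
  + by exists (inl i); rewrite /lab' eqxx.
- move=> e; split.
    move=> /mapP[_ /ent[j ->] ->] /=; exists j; rewrite /lab' /col' labz.
    by rewrite (_ : (inl j == inl i :> I + J) = (j == i)) //; case: eqP.
  move=> [j ->]; apply/mapP; exists (lab (inl j), col j); first by apply/ent; exists j.
  rewrite /= labz /lab' /col' (_ : (inl j == inl i :> I + J) = (j == i)) //.
  by case: eqP.
Qed.

End Realization.

(** * The finite search *)

Definition relation_wf (r : relation) : bool :=
  let: (z, z', p, n) := r in
  [&& is_cluster_id z, is_cluster_id z', z \notin p, z \notin n, z' \notin p & z' \notin n].

Fixpoint walk (T : exchanges) (path : seq nat) (a : combinatorial_seed) :
    option (seq positive) :=
  if path is i :: path' then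
    let e := nth (xH, ([::], [::])) a i in
    if (i < size a)%N then
      if mutate_seed T e.1 e.2 a is Some a' then
        omap (cat (map fst a)) (walk T path' a')
      else None
    else None
  else Some (map fst a).

(** The first nine mutations lead to a seed whose quiver is a tree with the
    sources and sinks at the positions 1, 2, 3, 6 and 0, 4, 5, 7. Since the
    Coxeter number of E8 is 30, the belt has period (30 + 2) / 2 = 16, and its
    seeds contain all cluster variables after 15 rounds. *)
Definition bipartite_belt : seq nat := [:: 0; 2; 1; 3; 6; 0; 2; 4; 6]%N ++
  flatten (nseq 15 [:: 1; 2; 3; 6; 0; 4; 5; 7]%N).

Lemma relations_wf : all relation_wf relations.
Proof. by vm_compute. Qed.

Definition holds_in (A : Type) (P : A -> bool) (o : option A) : bool :=
  if o is Some x then P x else false.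

Lemma holds_inP (A : Type) (P : A -> bool) (o : option A) :
  holds_in P o -> exists2 x, o = Some x & P x.
Proof. by case: o => // x; exists x. Qed.

Lemma bipartite_belt_covers :
  holds_in (fun ids => all (mem ids) cluster_ids) (walk exchange_table bipartite_belt initial_seed).
Proof. by vm_compute. Qed.

(** Each seed processed takes one unit of fuel, and there are 3148 classes. *)
Lemma exploration_terminates :
  holds_in xpredT (explore exchange_table (Nat.pow 2 12)
  (PositiveMap.add (seed_key (canonical_seed initial_seed)) (canonical_seed initial_seed)
     (PositiveMap.empty _)) [:: canonical_seed initial_seed]).
Proof. by vm_compute. Qed.

Section Exploration.
Variable T : exchanges.

Definition closed_in (V : seed_table) (es s : combinatorial_seed) : Prop :=
  forall z c, (z, c) \in es -> exists s' h,
    mutate_seed T z c s = Some s' /\ PositiveMap.find h V = Some (canonical_seed s').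

Definition extends (V V' : seed_table) : Prop :=
  forall h t, PositiveMap.find h V = Some t -> PositiveMap.find h V' = Some t.

Lemma closed_in_extends V V' es s : extends V V' -> closed_in V es s -> closed_in V' es s.
Proof.
by move=> VV' cl z c /cl[s' [h [m f]]]; exists s', h; split => //; exact: VV'.
Qed.

Lemma visit_neighboursP s es V W V' W' :
  visit_neighbours T s es V W = Some (V', W') ->
  [/\ extends V V', closed_in V' es s, {subset W <= W'} &
      forall h t, PositiveMap.find h V' = Some t ->
        PositiveMap.find h V = Some t \/ t \in W'].
Proof.
elim: es V W => [|[z c] es IH] V W /=; first by case=> <- <-; split=> //; left.
case m : mutate_seed => [s'|] //; set t := canonical_seed s'.
case f : PositiveMap.find => [t'|].
  case: eqP => // tt' /IH[VV' cl WW' new]; split=> // y d.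
  rewrite inE => /orP[/eqP[-> ->]|]; last exact: cl.
  by exists s', (seed_key t); split=> //; apply: VV'; rewrite f -tt'.
move=> /IH[VV' cl WW' new].
have VaV : extends V (PositiveMap.add (seed_key t) t V).
  move=> h u hu; rewrite PositiveMap.gso // => ht; by rewrite -ht hu in f.
split.
- by move=> h u /VaV/VV'.
- move=> y d; rewrite inE => /orP[/eqP[-> ->]|]; last exact: cl.
  by exists s', (seed_key t); split=> //; apply: VV'; rewrite PositiveMap.gss.
- by move=> w wW; apply: WW'; rewrite inE wW orbT.
- move=> h u /new[|]; last by right.
  case: (h =P seed_key t) => [->|ht]; last by rewrite PositiveMap.gso; [left|].
  by rewrite PositiveMap.gss => -[<-]; right; apply: WW'; rewrite mem_head.
Qed.

(** Invariant: a known seed is either still in the work list or has all its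
    neighbours in the table. The table only grows, so the second alternative
    persists. *)
Lemma exploreP fuel V W V' :
  (forall h t, PositiveMap.find h V = Some t -> t \in W \/ closed_in V t t) ->
  explore T fuel V W = Some V' ->
  extends V V' /\ forall h t, PositiveMap.find h V' = Some t -> closed_in V' t t.
Proof.
elim: fuel V W => [|fuel IH] V [|s W] //= inv.
  by case=> <-; split=> // h t /inv[].
case v : visit_neighbours => [[V1 W1]|] //.
have [VV1 cl WW1 new] := visit_neighboursP v.
move=> /IH[h t|V1V' cl']; last by split=> // h t /VV1/V1V'.
case/new => [/inv[]|]; last by left.
  by rewrite inE => /orP[/eqP->|/WW1]; [right|left].
by right; apply: closed_in_extends VV1 _.
Qed.

Lemma explore_closed fuel s0 :
  holds_in xpredT (explore T fuel
    (PositiveMap.add (seed_key s0) s0 (PositiveMap.empty _)) [:: s0]) ->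
  exists2 V, PositiveMap.find (seed_key s0) V = Some s0 &
    forall h t, PositiveMap.find h V = Some t -> closed_in V t t.
Proof.
move=> /holds_inP[V E _]; have [] := exploreP _ E.
  move=> h t; case: (h =P seed_key s0) => [->|hs].
    by rewrite PositiveMap.gss => -[<-]; left; rewrite mem_head.
  by rewrite PositiveMap.gso // PositiveMap.gempty.
by move=> start closed; exists V => //; apply: start; rewrite PositiveMap.gss.
Qed.

End Exploration.

Section ClusterVariables.
Variables (F : fieldType) (I J : finType) (val : positive -> F).
Hypothesis val_neq0 : forall x, is_cluster_id x -> val x != 0.
Hypothesis val_relations : forall z z' p n k, (z, z', p, n) \in relations ->
  val (rotate k z) * val (rotate k z') =
  monomial_value val k p + monomial_value val k n.

Lemma monomial_value_rotate k n p :
  monomial_value val k (sort Pos.leb (map (rotate n) p)) = monomial_value val (k + n) p.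
Proof.
rewrite monomial_value_sort /monomial_value big_map.
by apply: eq_bigr => x _; rewrite rotateD.
Qed.

Lemma valid_exchange_rotate n z z' c : valid_exchange val z z' c ->
  valid_exchange val (rotate n z) (rotate n z') (rotate_column n c).
Proof.
case=> z'c z1 z2 ex; split; rewrite ?is_cluster_id_rotate ?mem_rotate_rotate //.
by move=> k; rewrite !monomial_value_rotate -!rotateD ex.
Qed.

Lemma valid_exchanges_add T z z' c : valid_exchanges val T ->
  valid_exchange val z z' c -> valid_exchanges val (add_exchange z z' c T).
Proof.
move=> valT valc y y' d; rewrite /exchanges_of /add_exchange.
case: (y =P z) => [->|yz]; last by rewrite PositiveMap.gso // => /valT.
by rewrite PositiveMap.gss inE => /orP[/eqP[-> ->]|/valT].
Qed.

Lemma exchange_table_valid : valid_exchanges val exchange_table.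
Proof.
rewrite /exchange_table; move: relations_wf val_relations.
elim: relations (iota 0 8) => [|[[[z z'] p] n] rs IH] ks /=.
    move=> _ _ z z' c.
  by rewrite /exchanges_of PositiveMap.gempty.
move=> /andP[wf wfs] rel.
have {}IH := IH ks wfs (fun y y' q m k (r : (y, y', q, m) \in rs) =>
  rel y y' q m k (mem_behead (s := _ :: rs) r)).
elim: {2}ks => //= k ks' IHk; have {}rel k' := rel z z' p n k' (mem_head _ _).
case/and5P: wf => zc z'c zp zn /andP[z'p z'n].
apply: valid_exchanges_add; last by apply: valid_exchange_rotate; split.
apply: valid_exchanges_add => //; apply: valid_exchange_rotate; split=> //.
by move=> k'; rewrite mulrC rel.
Qed.

(** Every seed is realized by a seed of the explored table: the table is closed
    under mutation up to rotation, and rotations do not affect realizability. *)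
Lemma realizes_exploration (s0 s : seed_data F I J) k lab col (C : fieldType) (e : C -> F) :
  realizes val s0 initial_seed k lab col ->
  mutation_equivalent e s0 s ->
  forall i : I, exists2 x, is_cluster_id x & cluster s i = val x.
Proof.
move=> real0; have [V start closed] := explore_closed exploration_terminates.
move=> ms.
suff [a [h [k' [lab' [col' [_ real]]]]]] : exists a h k' lab' col',
    PositiveMap.find h V = Some a /\ realizes (J := J) val s a k' lab' col'.
  move=> i; exists (rotate k' (lab' (inl i))); last exact: (label_value real (inl i)).
  by rewrite is_cluster_id_rotate; exact: label_cluster real i.
elim: ms => [_|{}s i _ [a [h [k' [lab' [col' [aV real]]]]]]].
  by do 5 eexists; split; [exact: start|exact: realizes_rotate real0].
have ia : (lab' (inl i), col' i) \in a by apply/(seed_entries real); exists i.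
have [a' [h' [m a'V]]] := closed _ _ aV _ _ ia.
have [lab'' [col'' real']] := realizes_mutate val_neq0 exchange_table_valid real m.
by do 5 eexists; split; [exact: a'V|exact: realizes_rotate real'].
Qed.

Definition mutate_along (path : seq I) (s : seed_data F I J) : seed_data F I J :=
  foldl (fun s i => mutate i s) s path.

Lemma realizes_walk T path a (s : seed_data F I J) k lab col ids :
  valid_exchanges val T -> realizes val s a k lab col -> walk T path a = Some ids ->
  forall x, x \in ids -> exists ms i, cluster (mutate_along ms s) i = val (rotate k x).
Proof.
move=> valT; elim: path a s lab col ids => [|i path IH] a s lab col ids real /=.
  case=> <- x /mapP[_ /(seed_entries real)[i ->] ->].
  by exists [::], i; rewrite -(label_value real (inl i)).
case: ifP => // ia; case m : mutate_seed => [a'|] //.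
have [j ej] := (seed_entries real _).1 (mem_nth (xH, ([::], [::])) ia).
rewrite ej in m; have [lab' [col' real']] := realizes_mutate val_neq0 valT real m.
case w : walk => [xs|] //= [<-] x; rewrite mem_cat => /orP[|xxs].
  case/mapP => _ /(seed_entries real)[i' ->] ->.
  by exists [::], i'; rewrite -(label_value real (inl i')).
have [ms [i' h]] := IH _ _ _ _ _ real' w _ xxs.
by exists (j :: ms), i'.
Qed.

Lemma cluster_ids_reached (s0 : seed_data F I J) lab col x :
  realizes val s0 initial_seed 0 lab col -> x \in cluster_ids ->
  exists ms (i : I), cluster (mutate_along ms s0) i = val x.
Proof.
move=> real xc; have [ids w /allP/(_ x xc) xi] := holds_inP bipartite_belt_covers.
exact: realizes_walk exchange_table_valid real w _ xi.
Qed.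

End ClusterVariables.

(** * Values of regular functions on matrices *)

Section Evaluation.
Variables (C : numFieldType) (k n : nat).
Implicit Types (f g : coordring C k n) (M : 'M[C]_(k, n)).

(** A ring morphism in f, because the point is decomposable. *)
Definition value M f : C := regular_eval f (plucker M).

Lemma coordringP f : exists p : wedge_poly C k n, f = \pi_(coordring C k n) p.
Proof. by exists (repr f); rewrite reprK. Qed.

Lemma value_pi M p : value M (\pi_(coordring C k n) p) = wedge_eval p (plucker M).
Proof. exact: regular_evalE. Qed.

Lemma valueB M : {morph value M : f g / f - g}.
Proof.
move=> f g; have [p ->] := coordringP f; have [q ->] := coordringP g.
by rewrite -rmorphB !value_pi /wedge_eval mevalB.
Qed.

Lemma valueM M : {morph value M : f g / f * g}.
Proof.
move=> f g; have [p ->] := coordringP f; have [q ->] := coordringP g.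
by rewrite -rmorphM !value_pi /wedge_eval mevalM.
Qed.

Lemma value1 M : value M 1 = 1.
Proof. by rewrite -(rmorph1 (\pi_(coordring C k n))) value_pi /wedge_eval meval1. Qed.

HB.instance Definition _ M := GRing.isZmodMorphism.Build (coordring C k n) C (value M) (valueB M).
HB.instance Definition _ M := GRing.isMonoidMorphism.Build (coordring C k n) C (value M)
  (value1 M, valueM M).

(** The coordinate ring is the quotient by the ideal of the polynomials that
    vanish on decomposable forms. *)
Lemma coordring_ext f g : (forall M, value M f = value M g) -> f = g.
Proof.
move=> fg; have [p pf] := coordringP f; have [q qg] := coordringP g.
rewrite pf qg; apply/eqP; rewrite -Quotient.idealrBE.
apply/vanishingP => M; have := fg M; rewrite pf qg !value_pi.
by rewrite /wedge_eval mevalB => ->; rewrite subrr.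
Qed.

Lemma value_const M c : value M (regular_const k n c) = c.
Proof. by rewrite value_pi /wedge_eval mevalC. Qed.

Lemma value_Delta M (K : ksubset k n) :
  value M (Delta C k (val K)) = \det (colsub (ksubset_elt K) M).
Proof.
by rewrite /Delta valK value_pi /wedge_eval mevalXU enum_rankK ffunE.
Qed.

End Evaluation.

Lemma sorted_enum (n : nat) (A : {set 'I_n}) :
  sorted (fun i j : 'I_n => (i < j)%N) (enum A).
Proof.
rewrite /enum_mem -enumT; apply: sorted_filter; first by move=> x y z; exact: ltn_trans.
by have := iota_ltn_sorted 0 n; rewrite -(val_enum_ord n) sorted_map.
Qed.

Lemma enum_eq_sorted (n : nat) (A : {set 'I_n}) (s : seq 'I_n) :
  sorted (fun i j : 'I_n => (i < j)%N) s -> A =i s -> enum A = s.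
Proof.
move=> ss As; apply: (irr_sorted_eq (leT := fun i j : 'I_n => (i < j)%N)) => //.
- by move=> x y z; exact: ltn_trans.
- by move=> x; exact: ltnn.
- exact: sorted_enum.
by move=> x; rewrite mem_enum As.
Qed.

Section Minors.
Variables (C : numFieldType).
Implicit Types (M : 'M[C]_(3, 8)) (i j k : 'I_8).

Definition minor3 M i j k : C :=
  M 0 i * (M 1 j * M (inord 2) k - M 1 k * M (inord 2) j)
  - M 0 j * (M 1 i * M (inord 2) k - M 1 k * M (inord 2) i)
  + M 0 k * (M 1 i * M (inord 2) j - M 1 j * M (inord 2) i).

Lemma minor3_rot M i j k : minor3 M i j k = minor3 M j k i.
Proof. by rewrite /minor3; ring. Qed.

Lemma det_mx33 (A : 'M[C]_3) : \det A =
  A 0 0 * (A 1 1 * A (inord 2) (inord 2) - A 1 (inord 2) * A (inord 2) 1)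
  - A 0 1 * (A 1 0 * A (inord 2) (inord 2) - A 1 (inord 2) * A (inord 2) 0)
  + A 0 (inord 2) * (A 1 0 * A (inord 2) 1 - A 1 1 * A (inord 2) 0).
Proof.
pose a (r s : nat) : C := A (inord r) (inord s).
have aE (r s : 'I_3) : A r s = a r s by rewrite /a !inord_val.
rewrite (expand_det_row _ 0) !big_ord_recl big_ord0 /cofactor.
rewrite !(expand_det_row _ 0) !big_ord_recl !big_ord0 /cofactor.
by rewrite !det_mx11 !mxE !aE /= !inordK //= /bump /=; ring.
Qed.

Lemma value_Delta3_sorted M i j k : (i < j < k)%N ->
  value M (Delta3 C 8 i.+1 j.+1 k.+1) = minor3 M i j k.
Proof.
move=> /andP[ij jk]; rewrite /Delta3.
set K := [set _ | _]; have Ks : K =i [:: i; j; k].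
  by move=> x; rewrite !inE.
have eK : enum K = [:: i; j; k].
  by apply: enum_eq_sorted => //=; rewrite ij jk.
have cK : #|K| == 3 by rewrite cardE eK.
rewrite (value_Delta M (exist _ K cK : ksubset 3 8)) det_mx33 /minor3 !mxE.
have elt (r : 'I_3) : ksubset_elt (exist _ K cK : ksubset 3 8) r = nth i [:: i; j; k] r.
  by rewrite /ksubset_elt (enum_val_nth i) /= eK.
by rewrite !elt /= !inordK.
Qed.

(** A cyclic rotation of three labels is an even permutation, so the sorted minor
    that defines the left-hand side agrees with the minor in the given order. *)
Lemma value_Delta3 M i j k : [|| i < j < k, j < k < i | k < i < j]%N ->
  value M (Delta3 C 8 i.+1 j.+1 k.+1) = minor3 M i j k.
Proof.
have E a b c : Delta3 C 8 a b c = Delta3 C 8 b c a.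
  rewrite /Delta3; congr Delta; apply/setP => x; rewrite !inE.
  by rewrite [RHS]orbA [RHS]orbC.
case/or3P => h; first exact: value_Delta3_sorted.
  by rewrite E value_Delta3_sorted // -minor3_rot.
by rewrite -E value_Delta3_sorted // minor3_rot.
Qed.

End Minors.

(** * Formulas and polynomial identities *)

Delimit Scope Z_scope with BinZ.
Notation triple := (nat * nat * nat)%type.
(** A polynomial in the Pluecker coordinates, as a signed sum of products of
    triples of labels; [true] stands for the sign -1. *)
Notation plucker_formula := (seq (bool * seq triple)).

(** Labels run from 1 to 8. *)
Definition shift_label (k a : nat) : nat := ((a.-1 + k) %% 8).+1.

Definition shift_triple (k : nat) (t : triple) : triple :=
  let: (a, b, c) := t in (shift_label k a, shift_label k b, shift_label k c).

Definition shift_formula (k : nat) (f : plucker_formula) : plucker_formula :=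
  [seq (m.1, map (shift_triple k) m.2) | m <- f].

Definition formula_X (a : nat -> nat) : plucker_formula :=
  [:: (false, [:: (a 1, a 3, a 4); (a 2, a 5, a 6)]);
      (true, [:: (a 1, a 5, a 6); (a 2, a 3, a 4)])]%N.

Definition formula_Y (a : nat -> nat) : plucker_formula :=
  [:: (false, [:: (a 1, a 4, a 5); (a 2, a 3, a 6)]);
      (true, [:: (a 1, a 2, a 3); (a 4, a 5, a 6)])]%N.

Definition label_without (i j r : nat) : nat :=
  nth 0%N [seq x <- iota 1 8 | (x != i) && (x != j)] r.-1.

Definition formula_A : plucker_formula :=
  [:: (false, [:: (1, 3, 4); (2, 5, 8); (1, 6, 7)]);
      (true, [:: (1, 3, 4); (6, 7, 8); (1, 2, 5)]);
      (true, [:: (1, 5, 8); (2, 3, 4); (1, 6, 7)])]%N.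

Definition formula_B : plucker_formula :=
  [:: (false, [:: (2, 5, 8); (1, 3, 4); (2, 6, 7)]);
      (true, [:: (2, 3, 4); (1, 2, 8); (5, 6, 7)]);
      (true, [:: (2, 3, 4); (2, 5, 8); (1, 6, 7)])]%N.

Definition reflect_triple (t : triple) : triple :=
  let: (a, b, c) := t in (9 - c, 9 - b, 9 - a)%N.

(** The reversal of the labels, each triple being sorted again. This changes the
    sign of every minor, which is left out. *)
Definition reflect_formula (f : plucker_formula) : plucker_formula :=
  [seq (m.1, map reflect_triple m.2) | m <- f].

(** One formula in each orbit of names: the coefficients, the six other orbits of
    Pluecker coordinates, seven orbits of quadratic functions (a rotation
    exchanges the functions X and Y when it takes a label past 8), A, B, and the
    reflection of B. The orbit of A is stable under reflections up to sign. So the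
    names of the Pluecker coordinates of internal sets are 16 to 63, those of the
    quadratic functions 64 to 119, and those of the cubic functions 120 to 143. *)
Definition orbit_formulas : seq plucker_formula :=
  [seq [:: (false, [:: t])] | t <- [:: (1, 2, 3); (1, 2, 4); (1, 2, 5); (1, 2, 6);
                                   (1, 2, 7); (1, 3, 5); (1, 3, 6)]%N] ++
  [seq formula_X (label_without ij.1 ij.2) |
     ij <- [:: (1, 2); (1, 3); (1, 4); (1, 5); (1, 7); (2, 3); (2, 5)]%N] ++
  [:: formula_A; formula_B; reflect_formula formula_B].

Definition orbit_formula (q : positive) : plucker_formula :=
  nth [::] orbit_formulas (Pos.to_nat q).-1.

Definition formula_of (x : positive) : plucker_formula :=
  match x with
  | q~0~0~0 => shift_formula 0 (orbit_formula q) | q~0~0~1 => shift_formula 1 (orbit_formula q)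
  | q~0~1~0 => shift_formula 2 (orbit_formula q) | q~0~1~1 => shift_formula 3 (orbit_formula q)
  | q~1~0~0 => shift_formula 4 (orbit_formula q) | q~1~0~1 => shift_formula 5 (orbit_formula q)
  | q~1~1~0 => shift_formula 6 (orbit_formula q) | q~1~1~1 => shift_formula 7 (orbit_formula q)
  | _ => [::]
  end%positive.

(** The orders of three labels that rotations preserve and in which a minor has
    the same sign as the sorted one. *)
Definition cyclically_ordered (t : triple) : bool :=
  let: (a, b, c) := t in
  [|| a < b < c, b < c < a | c < a < b]%N &&
  [&& 0 < a <= 8, 0 < b <= 8 & 0 < c <= 8]%N.

Definition formula_wf (f : plucker_formula) : bool :=
  all (fun m => all cyclically_ordered m.2) f.

Notation entries := (nat -> nat -> PExpr Z).

Definition minor_expr (e : entries) (t : triple) : PExpr Z :=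
  let: (a, b, c) := t in
  let x r a := e r a.-1 in
  PEadd (PEsub
    (PEmul (x 0 a) (PEsub (PEmul (x 1 b) (x 2 c)) (PEmul (x 1 c) (x 2 b))))
    (PEmul (x 0 b) (PEsub (PEmul (x 1 a) (x 2 c)) (PEmul (x 1 c) (x 2 a)))))
    (PEmul (x 0 c) (PEsub (PEmul (x 1 a) (x 2 b)) (PEmul (x 1 b) (x 2 a))))%N.

Definition formula_expr (e : entries) (f : plucker_formula) : PExpr Z :=
  foldr (fun m acc => PEadd (PEmul (PEc (if m.1 then Zneg 1 else Zpos 1))
    (foldr (fun t acc => PEmul (minor_expr e t) acc) PEI m.2)) acc) PEO f.

Definition same_polynomial (p q : PExpr Z) : bool :=
  let norm := norm_subst Z0 (Zpos 1) Z.add Z.mul Z.sub Z.opp Zeq_bool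
    (triv_div Z0 (Zpos 1) Zeq_bool) 0 [::] in
  Peq Zeq_bool (norm p) (norm q).

(** The normal form: the first three columns are x1 e1, e2 and e3, and the other
    fifteen entries are free. *)
Definition chart_entries : entries := fun r c =>
  match c, r with
  | 0, 0 => PEX Z 1
  | 1, 1 | 2, 2 => PEI
  | 0, _ | 1, _ | 2, _ => PEO
  | _, _ => PEX Z (Pos.of_nat (3 * (c - 3) + r + 2))
  end%N.

Definition ids_expr (e : entries) (p : seq positive) : PExpr Z :=
  foldr (fun x acc => PEmul (formula_expr e (formula_of x)) acc) PEI p.

Definition relation_holds (r : relation) : bool :=
  let: (z, z', p, n) := r in
  same_polynomial
    (PEmul (formula_expr chart_entries (formula_of z)) (formula_expr chart_entries (formula_of z')))
    (PEadd (ids_expr chart_entries p) (ids_expr chart_entries n)).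

Lemma relations_hold : all relation_holds relations.
Proof. by vm_compute. Qed.

(** Any matrix will do on which the listed functions take distinct values, up to
    sign, that are not zero. *)
Definition sample : seq (seq Z) :=
  [:: [:: 1; 0; 0; -18; 19; -12; 9; 16];
      [:: 0; 1; 0; -3; 20; 4; -14; -15];
      [:: 0; 0; 1; 17; 10; -7; 8; 5]]%BinZ.
Definition sample_entries : entries := fun r c => PEc (nth Z0 (nth [::] sample r) c).

Definition sample_value (f : plucker_formula) : Z :=
  let norm := norm_subst Z0 (Zpos 1) Z.add Z.mul Z.sub Z.opp Zeq_bool
    (triv_div Z0 (Zpos 1) Zeq_bool) 0 [::] in
  if norm (formula_expr sample_entries f) is Pc z then z else Z0.

Lemma sample_values_correct :
  all (fun x => same_polynomial (formula_expr sample_entries (formula_of x))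
                  (PEc (sample_value (formula_of x)))) all_ids.
Proof. by vm_compute. Qed.

Definition sample_absolute_values : seq N :=
  [seq Z.abs_N (sample_value (formula_of x)) | x <- all_ids].

Lemma sample_values_distinct :
  (0%num \notin sample_absolute_values) && uniq sample_absolute_values.
Proof. by vm_compute. Qed.

Lemma formula_of_rotate k x : formula_of (rotate k x) = shift_formula k (formula_of x).
Proof.
have shiftD a b f : shift_formula a (shift_formula b f) = shift_formula (a + b) f.
  rewrite /shift_formula -map_comp; apply: eq_map => -[s ts] /=; congr (_, _).
  rewrite -map_comp; apply: eq_map => -[[u v] w] /=.
  by rewrite /shift_label /= !modnDml -!addnA (addnC b a).
have shift0 f : f \in orbit_formulas -> shift_formula 0 f = f /\ shift_formula 8 f = f.
  by move=> fo; split; apply/eqP; move: f fo; apply/allP; vm_compute.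
have shift8 q : shift_formula 8 (orbit_formula q) = shift_formula 0 (orbit_formula q).
  rewrite /orbit_formula; case: (ltnP (Pos.to_nat q).-1 (size orbit_formulas)) => h.
    by have [-> ->] := shift0 _ (mem_nth [::] h).
  by rewrite nth_default.
elim: k => [|k IH] /=.
  case: x => [[[q|q|]|[q|q|]|]|[[q|q|]|[q|q|]|]|] //=; by rewrite shiftD.
rewrite -addn1 addnC -shiftD -IH; move: (rotate k x) => y {IH x}.
case: y => [[[q|q|]|[q|q|]|]|[[q|q|]|[q|q|]|]|] //=; by rewrite shiftD.
Qed.

Lemma orbit_formula_wf q : all (fun k => formula_wf (shift_formula k (orbit_formula q))) (iota 0 8).
Proof.
rewrite /orbit_formula; case: (ltnP (Pos.to_nat q).-1 (size orbit_formulas)) => h; last by rewrite nth_default.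
move: (mem_nth [::] h); move: (nth _ _ _); apply/allP; by vm_compute.
Qed.

Lemma formula_of_wf x : formula_wf (formula_of x).
Proof.
have h q k : (k < 8)%N -> formula_wf (shift_formula k (orbit_formula q)).
  by move=> k8; apply: (allP (orbit_formula_wf q)); rewrite mem_iota.
by case: x => [[[q|q|]|[q|q|]|]|[[q|q|]|[q|q|]|]|] //=; exact: h.
Qed.

Section Semantics.
Variable C : numFieldType.

Definition regular_of (f : plucker_formula) : coordring C 3 8 :=
  \sum_(m <- f) (-1) ^+ m.1 * \prod_(t <- m.2) Delta3 C 8 t.1.1 t.1.2 t.2.

Definition integer_const : Z -> C := gen_phiZ 0 1 +%R *%R -%R.

Definition peval (l : seq C) (e : PExpr Z) : C :=
  PEeval 0 1 +%R *%R (fun x y => x - y) -%R integer_const id_phi_N (pow_N 1 *%R) l e.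

Lemma ring_theory_of : ring_theory (0 : C) 1 +%R *%R (fun x y => x - y) -%R eq.
Proof.
split=> //; [exact: add0r|exact: addrC|exact: addrA|exact: mul1r|exact: mulrC|
  exact: mulrA|exact: mulrDl|exact: addrN].
Qed.

Lemma ring_ext_of : ring_eq_ext +%R *%R -%R (@eq C).
Proof. by split=> [x y -> z t ->|x y -> z t ->|x y ->]. Qed.

Lemma same_polynomialP l p q : same_polynomial p q -> peval l p = peval l q.
Proof.
have st : RelationClasses.Equivalence (@eq C) := RelationClasses.eq_equivalence.
have art := Rth_ARth st ring_ext_of ring_theory_of.
have mor := gen_phiZ_morph st ring_ext_of ring_theory_of.
move=> h; exact: (ring_correct st ring_ext_of art mor (pow_N_th _ _ st)
  (triv_div_th st ring_ext_of art mor) 0 l [::] p q I h).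
Qed.

Definition entries_mx (e : entries) (l : seq C) : 'M[C]_(3, 8) :=
  \matrix_(r, c) peval l (e r c).

Lemma value_minor_expr e l t : cyclically_ordered t ->
  value (entries_mx e l) (Delta3 C 8 t.1.1 t.1.2 t.2) = peval l (minor_expr e t).
Proof.
case: t => [[[|a] [|b]] [|c]]; rewrite /= ?andbF // => /andP[h /and3P[a8 b8 c8]].
have := @value_Delta3 C (entries_mx e l) (Ordinal a8) (Ordinal b8) (Ordinal c8) h.
by move=> /= ->; rewrite /minor3 !mxE /= !inordK.
Qed.

Lemma value_regular_of M f : value M (regular_of f) =
  \sum_(m <- f) (-1) ^+ m.1 * \prod_(t <- m.2) value M (Delta3 C 8 t.1.1 t.1.2 t.2).
Proof.
rewrite /regular_of raddf_sum /=; apply: eq_bigr => m _.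
by rewrite rmorphM /= rmorphXn /= rmorphN1 rmorph_prod.
Qed.

Lemma value_formula_expr e l f : formula_wf f ->
  value (entries_mx e l) (regular_of f) = peval l (formula_expr e f).
Proof.
rewrite value_regular_of; elim: f => [|[s ts] f IH] /= => [_|/andP[ws wf]].
  by rewrite big_nil.
rewrite big_cons IH // /peval /= -!/(peval _ _); congr (_ * _ + _).
  by case: s.
elim: ts ws => [|t ts IHt] /= => [_|/andP[wt wts]]; first by rewrite big_nil.
by rewrite big_cons value_minor_expr // IHt.
Qed.

End Semantics.

(** * Identities on the cone of decomposable forms *)

Lemma uniq_map_inj (T U : eqType) (h : T -> U) (s : seq T) :
  uniq (map h s) -> {in s &, injective h}.
Proof.
elim: s => [|x s IH] //= /andP[xs us] y z; rewrite !inE.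
move=> /orP[/eqP->|ys] /orP[/eqP->|zs] // e; last exact: IH.
- by case/negP: xs; rewrite e map_f.
- by case/negP: xs; rewrite -e map_f.
Qed.

Section Chart.
Variable C : numFieldType.
Implicit Types (M : 'M[C]_(3, 8)) (f g : coordring C 3 8).

Definition chart (l : seq C) : 'M[C]_(3, 8) := entries_mx chart_entries l.

Definition first_columns : 'I_3 -> 'I_8 := widen_ord (isT : (3 <= 8)%N).

Lemma plucker_unimodular (k n : nat) (g : 'M[C]_k) (M : 'M[C]_(k, n)) :
  \det g = 1 -> plucker (g *m M) = plucker M.
Proof.
move=> g1; apply/ffunP => K; rewrite !ffunE.
have -> : colsub (ksubset_elt K) (g *m M) = g *m colsub (ksubset_elt K) M.
  by apply/matrixP => i j; rewrite !mxE; apply: eq_bigr => r _; rewrite !mxE.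
by rewrite det_mulmx g1 mul1r.
Qed.

(** Write a for the matrix of the first three columns and d for its determinant.
    Multiplication by diag (d, 1, 1) a^-1, of determinant 1, leaves the minors
    unchanged and makes the first three columns diagonal. *)
Lemma plucker_chart M : \det (colsub first_columns M) != 0 ->
  exists l, plucker M = plucker (chart l).
Proof.
set a := colsub _ _; set d := \det a => d0.
pose D (x : C) : 'M[C]_3 := diag_mx (\row_(j < 3) if j == 0 then x else 1).
have detD x : \det (D x) = x by rewrite det_diag !big_ord_recl big_ord0 !mxE /= !mulr1.
pose g := D d *m invmx a.
have g1 : \det g = 1 by rewrite det_mulmx detD det_inv divff.
have au : a \in unitmx by rewrite unitmxE unitfE.
pose N := g *m M.
exists (d :: [seq N (inord (i %% 3)) (inord (3 + i %/ 3)) | i <- iota 0 15]).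
rewrite -(plucker_unimodular M g1) -/N; congr plucker; apply/matrixP => r c.
case: (ltnP c 3) => c3; last first.
  rewrite [RHS]mxE /peval; case: r c c3 => [[|[|[|r]]] hr] // [[|[|[|[|[|[|[|[|c]]]]]]]] hc] //= _;
    by congr (N _ _); apply: val_inj; rewrite /= inordK.
have -> : N r c = (g *m a) r (Ordinal c3).
  by rewrite !mxE; apply: eq_bigr => s _; rewrite !mxE; congr (_ * M _ _); apply: val_inj.
rewrite /g -mulmxA mulVmx // mulmx1 !mxE.
by case: r c c3 => [[|[|[|r]]] hr] // [[|[|[|c]]] hc].
Qed.

Lemma value_Delta123 M : value M (Delta3 C 8 1 2 3) = \det (colsub first_columns M).
Proof.
have h : ((inord 0 : 'I_8) < (inord 1 : 'I_8) < (inord 2 : 'I_8))%N by rewrite !inordK.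
have := value_Delta3_sorted M h; rewrite !inordK // => ->.
rewrite det_mx33 /minor3 !mxE.
have e (r : nat) : (r < 3)%N -> first_columns (inord r) = inord r.
  by move=> r3; apply: val_inj; rewrite /= !inordK // (leq_trans r3).
rewrite -!(e 0%N) // -!(e 1%N) // -!(e 2%N) //.
have -> : inord 0 = 0 :> 'I_3 by apply: val_inj; rewrite /= inordK.
by have -> : inord 1 = 1 :> 'I_3 by apply: val_inj; rewrite /= inordK.
Qed.

Lemma integer_const_inj : injective (@integer_const C).
Proof.
have st : RelationClasses.Equivalence (@eq C) := RelationClasses.eq_equivalence.
have art := Rth_ARth st (@ring_ext_of C) (@ring_theory_of C).
have pos p : gen_phiPOS (1 : C) +%R *%R p = (Pos.to_nat p)%:R.
  rewrite -(same_gen st (@ring_ext_of C) art).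
  elim: p => [p IH|p IH|] //=; rewrite IH ?Pos2Nat.inj_xI ?Pos2Nat.inj_xO.
    by rewrite multE -[S _]addn1 natrD natrM addrC.
  by rewrite multE natrM.
have mor := gen_phiZ_morph st (@ring_ext_of C) (@ring_theory_of C).
move=> x y xy; have : integer_const C (Z.sub x y) = 0.
  by rewrite /integer_const (morph_sub mor) -/(integer_const _ _) xy subrr.
have pos0 p : gen_phiPOS (1 : C) +%R *%R p != 0.
  by rewrite pos pnatr_eq0 -lt0n; apply/ssrnat.ltP/Pos2Nat.is_pos.
case E : (Z.sub x y) => [|p|p] /=; first by move=> _; lia.
  by move/eqP; rewrite (negbTE (pos0 p)).
by move/eqP; rewrite oppr_eq0 (negbTE (pos0 p)).
Qed.

Definition regular_id (x : positive) : coordring C 3 8 := regular_of C (formula_of x).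

Lemma value_sample x : x \in all_ids ->
  value (entries_mx sample_entries [::]) (regular_id x) =
  integer_const C (sample_value (formula_of x)).
Proof.
move=> xi; rewrite value_formula_expr ?formula_of_wf //.
by have := allP sample_values_correct x xi => /same_polynomialP ->.
Qed.

Lemma regular_id_inj : {in all_ids &, injective regular_id}.
Proof.
move=> x y xi yi xy; have := value_sample xi; rewrite xy (value_sample yi).
move=> /integer_const_inj e; have /andP[_ u] := sample_values_distinct.
exact: (@uniq_map_inj _ _ (fun x => Z.abs_N (sample_value (formula_of x))) all_ids u x y
  xi yi (congr1 Z.abs_N (esym e))).
Qed.

Lemma regular_id_neq0 x : x \in all_ids -> regular_id x != 0.
Proof.
move=> xi; apply/eqP => x0; have := value_sample xi; rewrite x0 rmorph0.
move=> /esym e; have := @integer_const_inj (sample_value (formula_of x)) Z0 e => z0.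
have /andP[/negP h _] := sample_values_distinct; apply: h.
have -> : 0%num = Z.abs_N (sample_value (formula_of x)) by rewrite z0.
exact: (map_f (fun x => Z.abs_N (sample_value (formula_of x))) xi).
Qed.

(** The difference multiplied by the minor of the first three columns vanishes on
    every matrix, and this minor is not a zero divisor. *)
Lemma chart_ext f g : (forall l, value (chart l) f = value (chart l) g) -> f = g.
Proof.
move=> fg; have D0 : Delta3 C 8 1 2 3 != 0.
  have := @regular_id_neq0 8%positive isT; rewrite /regular_id /regular_of /= !big_seq1 /=.
  by rewrite expr0 mul1r.
apply: (mulIf D0); apply: coordring_ext => M; rewrite !rmorphM /=.
have [d0|d0] := eqVneq (\det (colsub first_columns M)) 0.
  by rewrite value_Delta123 d0 !mulr0.
have [l Ml] := plucker_chart d0.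
by congr (_ * _); rewrite /value Ml; exact: fg.
Qed.

Lemma same_polynomial_regular (f g : plucker_formula) :
  formula_wf f -> formula_wf g ->
  same_polynomial (formula_expr chart_entries f) (formula_expr chart_entries g) ->
  regular_of C f = regular_of C g.
Proof.
move=> wf wg /same_polynomialP fg; apply: chart_ext => l.
by rewrite !value_formula_expr.
Qed.

(** Rotating the columns keeps the triples cyclically ordered. *)
Lemma value_col_perm (c : nat) (s : 'S_8) M (f : plucker_formula) : formula_wf f ->
  (forall x, s x = (x + c) %% 8 :> nat)%N ->
  value (col_perm s M) (regular_of C f) = value M (regular_of C (shift_formula c f)).
Proof.
move=> wf sc; rewrite !value_regular_of big_map big_seq [RHS]big_seq.
apply: eq_bigr => -[b ts] /(allP wf) /= wts; congr (_ * _); rewrite big_map.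
rewrite big_seq [RHS]big_seq; apply: eq_bigr => -[[u v] w] /(allP wts).
case: u v w => [|i] [|j] [|k]; rewrite /= ?andbF // => /andP[h /and3P[i8 j8 k8]].
have S (x : nat) (x8 : (x < 8)%N) : ((x + c) %% 8)%N = s (Ordinal x8) by rewrite sc.
rewrite /shift_label /= (S _ i8) (S _ j8) (S _ k8) value_Delta3.
  rewrite (@value_Delta3 _ _ (Ordinal i8) (Ordinal j8) (Ordinal k8)) //.
  by rewrite /minor3 !mxE.
rewrite !sc /=; move: h; rewrite !ltnS; clear -i8 j8 k8.
have := ltn_pmod c (isT : (0 < 8)%N).
rewrite -(modnDmr i) -(modnDmr j) -(modnDmr k); move: (c %% 8)%N => r r8.
have md x : (x < 8)%N -> ((x + r) %% 8 = if x + r < 8 then x + r else x + r - 8)%N.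
  move=> x8; case: ltnP => h; first by rewrite modn_small.
  by rewrite -{1}(subnK h) modnDr modn_small //; lia.
by rewrite !md //; case: (ltnP (i + r) 8); case: (ltnP (j + r) 8); case: (ltnP (k + r) 8); lia.
Qed.

Lemma value_Delta3_label M (a b c : nat) : cyclically_ordered (a, b, c) ->
  value M (Delta3 C 8 a b c) = minor3 M (inord a.-1) (inord b.-1) (inord c.-1).
Proof.
case: a b c => [|a] [|b] [|c]; rewrite /= ?andbF // => /andP[h /and3P[a8 b8 c8]].
rewrite (@value_Delta3 C M (Ordinal a8) (Ordinal b8) (Ordinal c8)) //.
by congr minor3; apply: val_inj; rewrite /= inordK.
Qed.

Lemma rotation_exists (c : nat) : exists s : 'S_8, forall x, s x = ((x + c) %% 8)%N :> nat.
Proof.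
have inj : injective (fun x : 'I_8 => inord ((x + c) %% 8) : 'I_8).
  move=> x y /(congr1 val); rewrite /= !inordK ?ltn_pmod // => /eqP.
  by rewrite eqn_modDr !modn_small // => /eqP/val_inj.
by exists (perm inj) => x; rewrite permE inordK ?ltn_pmod.
Qed.

Lemma value_regular_id_rotate k (s : 'S_8) M x :
  (forall x, s x = (x + k) %% 8 :> nat)%N ->
  value M (regular_id (rotate k x)) = value (col_perm s M) (regular_id x).
Proof.
by move=> sk; rewrite /regular_id formula_of_rotate (value_col_perm _ _ sk) ?formula_of_wf.
Qed.

(** For k = 0 this is a verified identity; evaluating it at the matrix with rotated
    columns gives the identity for the rotated names. *)
Lemma regular_relations z z' p n k : (z, z', p, n) \in relations ->
  regular_id (rotate k z) * regular_id (rotate k z') =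
  \prod_(x <- p) regular_id (rotate k x) + \prod_(x <- n) regular_id (rotate k x).
Proof.
move=> r; have base : regular_id z * regular_id z' =
    \prod_(x <- p) regular_id x + \prod_(x <- n) regular_id x.
  apply: chart_ext => l; have := @same_polynomialP C l _ _ (allP relations_hold _ r).
  have ids q : peval l (ids_expr chart_entries q) = \prod_(x <- q) value (chart l) (regular_id x).
    elim: q => [|y q IH]; first by rewrite big_nil.
    by rewrite big_cons -IH value_formula_expr ?formula_of_wf.
  rewrite /peval /= -!/(peval _ _) !ids => e.
  rewrite rmorphM rmorphD !rmorph_prod /= -e.
  by rewrite !value_formula_expr ?formula_of_wf.
have [s sk] := rotation_exists k; apply: coordring_ext => M.
rewrite rmorphM rmorphD !rmorph_prod /= !(value_regular_id_rotate _ _ sk).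
under eq_bigr do rewrite (value_regular_id_rotate _ _ sk).
under [X in _ + X]eq_bigr do rewrite (value_regular_id_rotate _ _ sk).
by rewrite -!rmorph_prod -rmorphM -rmorphD base.
Qed.

End Chart.

(** * The initial seed *)

Definition cyclic_interval_mem (a : int) (l x : nat) : bool :=
  has (fun t : nat => ((x.+1)%:Z == a + t%:Z %[mod 8])%Z) (iota 0 l).

Lemma mem_cyclic_interval (a : int) (l : nat) (x : 'I_8) :
  (x \in cyclic_interval 8 a l) = cyclic_interval_mem a l x.
Proof.
rewrite inE; apply/existsP/hasP => [[t h]|[t]].
  by exists (t : nat); rewrite // mem_iota ltn_ord.
by rewrite mem_iota => /= tl h; exists (Ordinal tl).
Qed.

Definition grid_mem (i j x : nat) : bool :=
  let p := 8%:Z - 3%:Z - ((i%:Z + j%:Z - 2) %/ 2)%Z in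
  let p' := 8%:Z - 3%:Z + 2 + ((i%:Z + j%:Z - 1) %/ 2)%Z in
  cyclic_interval_mem p i x || cyclic_interval_mem p' (3 - i) x.

Lemma mem_grid_set (i j : nat) (x : 'I_8) : (x \in grid_set 3 8 i j) = grid_mem i j x.
Proof. by rewrite inE !mem_cyclic_interval. Qed.

Definition triple_mem (t : triple) (x : nat) : bool :=
  x.+1 \in [:: t.1.1; t.1.2; t.2].

Lemma mem_triple (t : triple) (x : 'I_8) :
  (x \in [set y : 'I_8 | y.+1 \in [:: t.1.1; t.1.2; t.2]]) = triple_mem t x.
Proof. by rewrite inE. Qed.

Definition same_members (a b : nat -> bool) : bool := all (fun x => a x == b x) (iota 0 8).

(** Reduces the equality of two sets of columns to a computation with their
    membership functions. *)
Lemma eq_set_members (A B : {set 'I_8}) (a b : nat -> bool) :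
  (forall x : 'I_8, (x \in A) = a x) -> (forall x : 'I_8, (x \in B) = b x) ->
  (A == B) = same_members a b.
Proof.
move=> Aa Bb; apply/eqP/allP => [AB x|ab].
  by rewrite mem_iota => /= x8; rewrite -(Aa (Ordinal x8)) -(Bb (Ordinal x8)) AB.
by apply/setP => x; rewrite Aa Bb; apply/eqP/ab; rewrite mem_iota /= ltn_ord.
Qed.

(** The mutable row (i + 1, j + 1) of the grid has position 4 i + j in
    [initial_seed]; the coefficient a is the (a + 1)-st cyclic interval. *)
Definition initial_label (r : (nat * nat) + nat) : positive :=
  match r with
  | inl ij => (nth (xH, ([::], [::])) initial_seed (4 * ij.1 + ij.2)).1
  | inr a => Pos.of_nat (8 + a)
  end.

Definition initial_column (ij : nat * nat) : column :=
  (nth (xH, ([::], [::])) initial_seed (4 * ij.1 + ij.2)).2.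

Definition row_mem (r : (nat * nat) + nat) : nat -> bool :=
  match r with
  | inl ij => grid_mem ij.1.+1 ij.2.+1
  | inr a => cyclic_interval_mem (a.+1)%:Z 3
  end.

(** Membership functions instead of sets make this computable. *)
Definition initial_entry (r : (nat * nat) + nat) (ij : nat * nat) : int :=
  let: (i, j) := ij in let K := row_mem r in
  if same_members K (grid_mem i.+2 j.+1) || same_members K (grid_mem i j.+1)
  then (-1) ^+ (i.+1 + j.+1)
  else if same_members K (grid_mem i.+1 j.+2) || same_members K (grid_mem i.+1 j)
  then - (-1) ^+ (i.+1 + j.+1)
  else 0.

Definition mutable_labels : seq (nat * nat) := [seq (i, j) | i <- iota 0 2, j <- iota 0 4].

Definition row_labels : seq ((nat * nat) + nat) :=
  map inl mutable_labels ++ map inr (iota 0 8).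

Definition single_triple (f : plucker_formula) : triple :=
  if f is [:: (false, [:: t])] then t else (0, 0, 0)%N.

Definition is_single (f : plucker_formula) : bool :=
  f == [:: (false, [:: single_triple f])].

Lemma initial_entries_correct :
  all (fun r => all (fun ij => initial_entry r ij ==
     exchange_entry (initial_label r) (initial_column ij)) mutable_labels) row_labels.
Proof. by vm_compute. Qed.

Lemma initial_labels_correct :
  all (fun r => is_single (formula_of (initial_label r)) &&
     same_members (row_mem r) (triple_mem (single_triple (formula_of (initial_label r))))) row_labels.
Proof. by vm_compute. Qed.

Lemma initial_labels_uniq : uniq (map initial_label row_labels).
Proof. by vm_compute. Qed.

Lemma initial_labels_kind :
  all (fun r => is_cluster_id (initial_label r) == (if r is inl _ then true else false)) row_labels.
Proof. by vm_compute. Qed.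

Lemma initial_columns_wf :
  all (fun ij => [&& all (fun x => x \notin (initial_column ij).2) (initial_column ij).1
    & all (fun x => x \in map initial_label row_labels)
        ((initial_column ij).1 ++ (initial_column ij).2)]) mutable_labels.
Proof. by vm_compute. Qed.

Lemma initial_skew : all (fun ij => all (fun kl =>
  initial_entry (inl ij) kl == - initial_entry (inl kl) ij) mutable_labels) mutable_labels.
Proof. by vm_compute. Qed.

Lemma initial_seed_labels :
  initial_seed = [seq (initial_label (inl ij), initial_column ij) | ij <- mutable_labels].
Proof. by vm_compute. Qed.

Section InitialSeed.
Variable C : numFieldType.
Notation I := ('I_2 * 'I_4)%type.
Notation J := 'I_8.

Definition row_code (r : I + J) : (nat * nat) + nat :=
  match r with inl c => inl (c.1 : nat, c.2 : nat) | inr a => inr (a : nat) end.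

Lemma mutable_code_in (c : I) : (c.1 : nat, c.2 : nat) \in mutable_labels.
Proof.
by apply/allpairsP; exists (c.1 : nat, c.2 : nat); rewrite !mem_iota /= !ltn_ord.
Qed.

Lemma row_code_in (r : I + J) : row_code r \in row_labels.
Proof.
rewrite mem_cat; case: r => [c|a]; apply/orP; [left|right].
  exact: (map_f inl (mutable_code_in c)).
by apply: (map_f inr); rewrite mem_iota /= ltn_ord.
Qed.

Lemma row_code_inj : injective row_code.
Proof.
move=> [[i j]|a] [[i' j']|a'] //= [].
  by move=> /val_inj -> /val_inj ->.
by move=> /val_inj ->.
Qed.

Lemma mutable_labels_code ij : ij \in mutable_labels -> exists c : I, ij = (c.1 : nat, c.2 : nat).
Proof.
case/allpairsP => -[i j] []; rewrite !mem_iota => /andP[_ i2] /andP[_ j4] ->.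
by exists (Ordinal i2, Ordinal j4).
Qed.

Definition id_value (x : positive) : ratfun C 3 8 := frac_of (regular_id C x).

Let s0 : seed_data (ratfun C 3 8) I J := grassmannian_seed C 3 8.

Lemma regular_of_single t : regular_of C [:: (false, [:: t])] = Delta3 C 8 t.1.1 t.1.2 t.2.
Proof. by rewrite /regular_of big_seq1 big_seq1 expr0 mul1r. Qed.

Lemma regular_id_set x (A : {set 'I_8}) (a : nat -> bool) :
  is_single (formula_of x) -> (forall y : 'I_8, (y \in A) = a y) ->
  same_members a (triple_mem (single_triple (formula_of x))) ->
  Delta C 3 A = regular_id C x.
Proof.
move=> /eqP fx Aa same; rewrite /regular_id fx regular_of_single /Delta3.
congr Delta; apply/eqP; rewrite (eq_set_members Aa (mem_triple _)).
exact: same.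
Qed.

Lemma initial_exchange r c :
  exchange s0 r c =
  exchange_entry (initial_label (row_code r)) (initial_column (c.1 : nat, c.2 : nat)).
Proof.
have /eqP <- := allP (allP initial_entries_correct _ (row_code_in r)) _ (mutable_code_in c).
rewrite /initial_entry /=; set K := (match r with inl _ => _ | inr _ => _ end).
have Kr (x : 'I_8) : (x \in K) = row_mem (row_code r) x.
  by rewrite /K; case: r {K} => [d|a] /=; rewrite ?mem_grid_set ?mem_cyclic_interval.
by rewrite !inE !(eq_set_members Kr (mem_grid_set _ _)).
Qed.

Lemma initial_value r : extended_cluster s0 r = id_value (initial_label (row_code r)).
Proof.
have /andP[single same] := allP initial_labels_correct _ (row_code_in r).
case: r single same => [c|a] single same; congr frac_of; apply: regular_id_set single _ same.
  by move=> x; rewrite mem_grid_set.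
by move=> x; rewrite mem_cyclic_interval.
Qed.

Lemma initial_seed_realized :
  realizes id_value s0 initial_seed 0 (fun r => initial_label (row_code r))
    (fun c => initial_column (c.1 : nat, c.2 : nat)).
Proof.
split.
- move=> r r' /(uniq_map_inj initial_labels_uniq (row_code_in r) (row_code_in r')).
  exact: row_code_inj.
- by move=> c; have /eqP := allP initial_labels_kind _ (row_code_in (inl c)).
- by move=> a; have /eqP -> := allP initial_labels_kind _ (row_code_in (inr a)).
- exact: initial_value.
- by move=> c r; exact: initial_exchange.
- move=> c x xc; have /andP[/allP/(_ x xc) h _] := allP initial_columns_wf _ (mutable_code_in c).
  exact: h.
- move=> c x xc; have /andP[_ /allP/(_ x xc)/mapP[r]] := allP initial_columns_wf _ (mutable_code_in c).
  rewrite mem_cat => /orP[] /mapP[y yr ->] ->.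
    by have [d ->] := mutable_labels_code yr; exists (inl d).
  by move: yr; rewrite mem_iota => /= y8; exists (inr (Ordinal y8)).
- move=> e; rewrite initial_seed_labels; split.
    by move=> /mapP[ij /mutable_labels_code[c ->] ->]; exists c.
  by move=> [c ->]; apply: (map_f (fun ij => (initial_label (inl ij), initial_column ij))); exact: mutable_code_in.
Qed.

Lemma initial_skew_symmetrizable : skew_symmetrizable (fun i j => exchange s0 (inl i) j).
Proof.
exists (fun=> 1) => // c d; rewrite !mul1r !initial_exchange.
have /eqP <- := allP (allP initial_entries_correct _ (row_code_in (inl c))) _ (mutable_code_in d).
have /eqP <- := allP (allP initial_entries_correct _ (row_code_in (inl d))) _ (mutable_code_in c).
by apply/eqP; exact: (allP (allP initial_skew _ (mutable_code_in c)) _ (mutable_code_in d)).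
Qed.

End InitialSeed.

(** * Rational dependence and non-vanishing *)

Lemma fraction_quotient (R : idomainType) (f : {fraction R}) :
  exists a b : R, b != 0 /\ f = FracField.tofrac a / FracField.tofrac b.
Proof.
elim/quotW: f => x; exists (frac x).1, (frac x).2.
have d0 := denom_ratioP x; split=> //.
apply: (canRL (mulfK _)); first by rewrite tofrac_eq0.
unlock FracField.tofrac; rewrite -[LHS]FracField.pi_mul; apply/eqmodP.
rewrite /= FracField.equivfE /FracField.mulf !numden_Ratio ?mulf_neq0 ?oner_eq0 //.
by rewrite !mulr1 mulrC.
Qed.

Section Rational.
Variables (C F : fieldType) (e : {rmorphism C -> F}) (T : finType) (x : T -> F).

Definition poly_value (p : {mpoly C[#|T|]}) : F := mmap e (fun i => x (enum_val i)) p.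

(** f belongs to the subfield generated by the x t. *)
Definition rational_in (f : F) : Prop :=
  exists p q, poly_value q != 0 /\ f * poly_value q = poly_value p.

Lemma poly_value1 : poly_value 1 = 1. Proof. exact: rmorph1. Qed.
Lemma poly_valueD : {morph poly_value : p q / p + q}. Proof. exact: rmorphD. Qed.
Lemma poly_valueM : {morph poly_value : p q / p * q}. Proof. exact: rmorphM. Qed.

Lemma rational_const c : rational_in (e c).
Proof. by exists c%:MP, 1; rewrite poly_value1 oner_neq0 mulr1 /poly_value mmapC. Qed.

Lemma rational_var t : rational_in (x t).
Proof.
exists 'X_(enum_rank t), 1; rewrite poly_value1 oner_neq0 mulr1; split=> //.
by rewrite /poly_value mmapX mmap1U enum_rankK.
Qed.

Lemma rationalD f g : rational_in f -> rational_in g -> rational_in (f + g).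
Proof.
move=> [p [q [q0 fq]]] [p' [q' [q'0 gq]]]; exists (p * q' + p' * q), (q * q').
rewrite poly_valueD !poly_valueM; split; first exact: mulf_neq0.
by rewrite -fq -gq; ring.
Qed.

Lemma rationalM f g : rational_in f -> rational_in g -> rational_in (f * g).
Proof.
move=> [p [q [q0 fq]]] [p' [q' [q'0 gq]]]; exists (p * p'), (q * q').
rewrite !poly_valueM; split; first exact: mulf_neq0.
by rewrite -fq -gq; ring.
Qed.

Lemma rational0 : rational_in 0.
Proof. by rewrite -(rmorph0 e); exact: rational_const. Qed.

Lemma rational1 : rational_in 1.
Proof. by rewrite -(rmorph1 e); exact: rational_const. Qed.

Lemma rationalV f : rational_in f -> rational_in f^-1.
Proof.
move=> [p [q [q0 fq]]]; have [->|f0] := eqVneq f 0; first by rewrite invr0; exact: rational0.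
exists q, p; rewrite -fq mulf_neq0 // mulKf //.
Qed.

Lemma rationalX f n : rational_in f -> rational_in (f ^+ n).
Proof.
by move=> rf; elim: n => [|n IH]; rewrite ?expr0 ?exprS; [exact: rational1|exact: rationalM].
Qed.

Lemma rational_prod (I : Type) (r : seq I) (P : pred I) (f : I -> F) :
  (forall i, rational_in (f i)) -> rational_in (\prod_(i <- r | P i) f i).
Proof.
by move=> rf; apply: big_ind => //; [exact: rational1|move=> *; exact: rationalM].
Qed.

(** If f q(x) = p(x) with q(x) nonzero, the polynomial q(X) Y - p(X) is a relation
    between x and f. It is not zero, since otherwise q(x) y = p(x) would hold for
    all y, in particular for y = 0 and y = 1. *)
Lemma rational_dependent f : rational_in f -> ~ alg_independent e (fun o : option T => oapp x f o).
Proof.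
move=> [p [q [q0 fq]]] indep.
pose emb (r : {mpoly C[#|T|]}) : {mpoly C[#|{: option T}|]} :=
  mmap (@mpolyC _ C) (fun i => 'X_(enum_rank (Some (enum_val i)))) r.
have emb_value (y : option T -> F) r :
    mmap e (fun i => y (enum_val i)) (emb r) = mmap e (fun i => y (Some (enum_val i))) r.
  have -> : emb r = \sum_(m <- msupp r) (r@_m)%:MP *
      mmap1 (fun i => 'X_(enum_rank (Some (enum_val i)))) m by [].
  rewrite raddf_sum /=; apply: eq_bigr => m _.
  rewrite rmorphM /= mmapC; congr (_ * _).
  rewrite /mmap1 rmorph_prod; apply: eq_bigr => i _.
  by rewrite rmorphXn /= mmapX mmap1U enum_rankK.
pose r := emb q * 'X_(enum_rank None) - emb p.
have rv (y : F) : mmap e (fun i => oapp x y (enum_val i)) r = poly_value q * y - poly_value p.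
  rewrite /r rmorphB rmorphM /= !emb_value mmapX mmap1U enum_rankK.
  by [].
have r0 : r = 0 by apply: indep; rewrite rv mulrC fq subrr.
have p0 : poly_value p = 0.
  by have := rv 0; rewrite r0 rmorph0 mulr0 sub0r => /esym/eqP; rewrite oppr_eq0 => /eqP.
have := rv 1; rewrite r0 rmorph0 p0 mulr1 subr0 => /esym/eqP.
by rewrite (negbTE q0).
Qed.

Variables I J : finType.

Lemma rational_mutate_along (path : seq I) (s : seed_data F I J) :
  (forall r, rational_in (extended_cluster s r)) ->
  forall r, rational_in (extended_cluster (mutate_along path s) r).
Proof.
elim: path s => [|i path IH] s rs //=; apply: IH => -[j|j]; last exact: (rs (inr j)).
rewrite /=; case: eqP => _; last exact: (rs (inl j)).
apply: rationalM; last by apply/rationalV; exact: (rs (inl i)).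
by apply: rationalD; apply: rational_prod => r; apply: rationalX.
Qed.

End Rational.

Section NonzeroPoint.
Variable C : numFieldType.

Lemma digits_inj (B n : nat) (a b : 'I_n -> nat) :
  (forall i, a i < B)%N -> (forall i, b i < B)%N ->
  (\sum_i a i * B ^ i = \sum_i b i * B ^ i)%N -> a =1 b.
Proof.
elim: n a b => [|n IH] a b aB bB; first by move=> _ [].
have split (c : 'I_n.+1 -> nat) : (\sum_i c i * B ^ i = c ord0 + (\sum_i c (lift ord0 i) * B ^ i) * B)%N.
  rewrite big_ord_recl expn0 muln1 big_distrl /=; congr (_ + _)%N.
  by apply: eq_bigr => i _; rewrite /bump /= expnS; lia.
rewrite !split => e.
have B0 : (0 < B)%N by apply: leq_ltn_trans (aB ord0).
have e0 : a ord0 = b ord0.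
  have := congr1 (modn^~ B) e; rewrite /= ![(_ + _ * B)%N]addnC !modnMDl.
  by rewrite !modn_small.
move: e; rewrite e0 => /addnI/eqP; rewrite eqn_pmul2r // => /eqP e.
have h := IH _ _ (fun i => aB (lift ord0 i)) (fun i => bB (lift ord0 i)) e.
by move=> i; case: (unliftP ord0 i) => [j ->|->] //; exact: h.
Qed.

Lemma exists_nonzero_nonroot (q : {poly C}) : q != 0 -> exists t, t != 0 /\ q.[t] != 0.
Proof.
move=> q0; pose r := q * 'X; have r0 : r != 0 by rewrite mulf_neq0 ?polyX_eq0.
suff [t] : exists t, ~~ root r t.
  by rewrite /root hornerM hornerX mulf_eq0 negb_or => /andP[h1 h2]; exists t.
pose s := [seq i%:R : C | i <- iota 0 (size r)].
have [/allP h|/allPn[t _ ht]] := boolP (all (root r) s); last by exists t.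
have us : uniq s by rewrite map_inj_uniq ?iota_uniq // => i j /eqP; rewrite eqr_nat => /eqP.
by have := max_poly_roots r0 (introT allP h) us; rewrite size_map size_iota ltnn.
Qed.

(** Kronecker substitution: for B larger than all exponents, substituting
    t ^ (B ^ i) for the i-th variable maps distinct monomials to distinct powers
    of t, and the resulting polynomial in t has a nonzero non-root. *)
Lemma mpoly_nonzero_point (n : nat) (p : {mpoly C[n]}) : p != 0 ->
  exists c : 'I_n -> C, (forall i, c i != 0) /\ p.@[c] != 0.
Proof.
move=> p0; pose B := (\sum_(m <- msupp p) \sum_i m i).+1.
have mB m i : m \in msupp p -> (m i < B)%N.
  move=> mp; rewrite ltnS /B (big_rem m) //= (bigD1 i) //=; lia.
pose w (m : 'X_{1..n}) := (\sum_i m i * B ^ i)%N.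
pose q : {poly C} := \sum_(m <- msupp p) p@_m *: 'X^(w m).
have qt t : q.[t] = p.@[fun i => t ^+ (B ^ i)].
  rewrite mevalE horner_sum; apply: eq_bigr => m _.
  rewrite hornerZ hornerXn; congr (_ * _); rewrite /w.
  rewrite expr_sum; apply: eq_bigr => i _; by rewrite mulnC exprM.
have [m mp] : exists m, m \in msupp p.
  by exists (mlead p); exact: mlead_supp.
have q0 : q != 0.
  apply/eqP => q0; have := mp; rewrite mcoeff_msupp => /eqP; apply.
  have <- : q`_(w m) = p@_m; last by rewrite q0 coef0.
  rewrite coef_sum (big_rem m) //= coefZ coefXn eqxx mulr1 big_seq big1 ?addr0 // => m' m'p.
  have m'mp : m' \in msupp p by apply: mem_rem m'p.
  rewrite coefZ coefXn; case: eqP => [wm|]; last by rewrite mulr0.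
  have mm' : m = m'.
    by apply/mnmP; apply: (@digits_inj B) => // i; exact: mB.
  by move: m'p; rewrite mm' rem_filter ?msupp_uniq // mem_filter /= eqxx.
have [t [t0 qt0]] := exists_nonzero_nonroot q0.
by exists (fun i => t ^+ (B ^ i)); split=> [i|]; rewrite ?expf_neq0 // -qt.
Qed.

End NonzeroPoint.

(** * The initial seed is a seed *)

Lemma ratfun_const_zmod_morphism (C : numFieldType) k n :
  zmod_morphism (@ratfun_const C k n).
Proof.
move=> c d; rewrite /ratfun_const /frac_of -rmorphB; congr FracField.tofrac.
by rewrite /regular_const -!rmorphB.
Qed.

Lemma ratfun_const_monoid_morphism (C : numFieldType) k n :
  monoid_morphism (@ratfun_const C k n).
Proof.
split=> [|c d]; rewrite /ratfun_const /frac_of.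
  by rewrite /regular_const !rmorph1.
by rewrite -rmorphM; congr FracField.tofrac; rewrite /regular_const -!rmorphM.
Qed.

HB.instance Definition _ (C : numFieldType) k n := GRing.isZmodMorphism.Build C (ratfun C k n)
  (@ratfun_const C k n) (@ratfun_const_zmod_morphism C k n).
HB.instance Definition _ (C : numFieldType) k n := GRing.isMonoidMorphism.Build C (ratfun C k n)
  (@ratfun_const C k n) (@ratfun_const_monoid_morphism C k n).

Section InitialMinors.
Variable C : numFieldType.

Definition initial_ids : seq positive := map initial_label row_labels.

Lemma value_single (M : 'M[C]_(3, 8)) x : is_single (formula_of x) ->
  let t := single_triple (formula_of x) in
  value M (regular_id C x) = minor3 M (inord t.1.1.-1) (inord t.1.2.-1) (inord t.2.-1).
Proof.
move=> /eqP fx t; rewrite /regular_id fx regular_of_single -/t.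
have : formula_wf (formula_of x) := formula_of_wf x.
rewrite fx -/t /formula_wf /= !andbT; case: (t) => [[a b] c].
exact: value_Delta3_label.
Qed.

Definition matrix_of_rows (rows : seq (seq C)) : 'M[C]_(3, 8) :=
  \matrix_(i, j) nth 0 (nth [::] rows i) j.

(** A matrix with prescribed nonzero initial minors is solved for column by column,
    starting from v1, v4, v5, which can be taken to be multiples of the basis
    vectors. *)
Lemma initial_minors_free
  (d123 d234 d345 d456 d567 d678 d178 d128 d578 d158 d148 d124 d568 d458 d145 d134 : C) :
  d123 != 0 -> d234 != 0 -> d345 != 0 -> d456 != 0 -> d567 != 0 -> d678 != 0 ->
  d178 != 0 -> d128 != 0 -> d578 != 0 -> d158 != 0 -> d148 != 0 -> d124 != 0 ->
  d568 != 0 -> d458 != 0 -> d145 != 0 -> d134 != 0 ->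
  exists M : 'M[C]_(3, 8), let D a b c := minor3 M (inord a.-1) (inord b.-1) (inord c.-1) in
  [/\ D 1 2 3 = d123, D 2 3 4 = d234, D 3 4 5 = d345 & D 4 5 6 = d456]%N /\
  [/\ D 5 6 7 = d567, D 6 7 8 = d678, D 7 8 1 = d178 & D 8 1 2 = d128]%N /\
  [/\ D 7 8 5 = d578, D 8 1 5 = d158, D 8 1 4 = d148 & D 1 2 4 = d124]%N /\
  [/\ D 5 6 8 = d568, D 4 5 8 = d458, D 4 5 1 = d145 & D 3 4 1 = d134]%N.
Proof.
move=> n123 n234 n345 n456 n567 n678 n178 n128 n578 n158 n148 n124 n568 n458 n145 n134.
pose x8 := d458; pose y8 := - d158 / d145; pose z8 := d148 / d145.
(* The three-term relation between the minors 168, 178, 568, 678, 158, 578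
   determines 168, after which v6 is given by the minors 456, 568, 168. *)
pose d168 := (d178 * d568 + d678 * d158) / d578.
pose x6 := d456; pose y6 := (d456 * y8 - d568) / d458; pose z6 := (y6 * z8 - d168 / d145) / y8.
(* Similarly, the minor 245, which is the first coordinate of v2. *)
pose x2 := (d345 * d124 + d234 * d145) / d134; pose z2 := - d124 / d145.
pose y2 := (d128 / d145 + z2 * y8) / z8.
(* A coordinate of v3, from those of v1, v2, v4, and of v7, from those of
   v5, v6, v8, by Cramer's rule. *)
pose v3 a b c := (- d234 * a + d134 * b + d123 * c) / d124.
pose v7 a b c := (- d678 * a + d578 * b + d567 * c) / d568.
exists (matrix_of_rows [:: [:: d145; x2; v3 d145 x2 0; 0; 0; x6; v7 0 x6 x8; x8];
                         [:: 0; y2; v3 0 y2 1; 1; 0; y6; v7 0 y6 y8; y8];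
                         [:: 0; z2; v3 0 z2 0; 0; 1; z6; v7 1 z6 z8; z8]]).
rewrite /minor3 !mxE /= !inordK //= /v3 /v7 /y2 /x2 /z2 /z6 /y6 /x6 /d168 /x8 /y8 /z8.
by repeat split; field; rewrite ?n123 ?n234 ?n345 ?n456 ?n567 ?n678 ?n178 ?n128 ?n578 ?n158
  ?n148 ?n124 ?n568 ?n458 ?n145 ?n134.
Qed.

Lemma initial_values_free (d : positive -> C) :
  (forall x, x \in initial_ids -> d x != 0) ->
  exists M, forall x, x \in initial_ids -> value M (regular_id C x) = d x.
Proof.
move=> d0; pose D n := d (Pos.of_nat n).
have nz n : Pos.of_nat n \in initial_ids -> D n != 0 by exact: d0.
have [M] := @initial_minors_free
  (D 8) (D 9) (D 10) (D 11) (D 12) (D 13) (D 14) (D 15)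
  (D 46) (D 39) (D 31) (D 16) (D 20) (D 27) (D 35) (D 42)
  (nz 8%N isT) (nz 9%N isT) (nz 10%N isT) (nz 11%N isT) (nz 12%N isT) (nz 13%N isT) (nz 14%N isT) (nz 15%N isT)
  (nz 46%N isT) (nz 39%N isT) (nz 31%N isT) (nz 16%N isT) (nz 20%N isT) (nz 27%N isT) (nz 35%N isT) (nz 42%N isT).
move=> [[e1 e2 e3 e4] [[e5 e6 e7 e8] [[e9 e10 e11 e12] [e13 e14 e15 e16]]]].
exists M.
have -> : initial_ids = map Pos.of_nat [:: 46; 39; 31; 16; 20; 27; 35; 42; 8; 9; 10; 11; 12; 13; 14; 15]%N.
  by vm_compute.
move=> x; rewrite !inE.
do 15 (case/orP=> [/eqP->|]; first by rewrite value_single).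
by move=> /eqP->; rewrite value_single.
Qed.

End InitialMinors.

Section InitialIsSeed.
Variable C : numFieldType.
Notation I := ('I_2 * 'I_4)%type.
Notation J := 'I_8.
Notation s0 := (grassmannian_seed C 3 8 : seed_data (ratfun C 3 8) I J).

Lemma initial_label_in (r : I + J) : initial_label (row_code r) \in initial_ids.
Proof. exact: map_f (row_code_in r). Qed.

Lemma frac_of_poly_value (T : finType) (y : T -> coordring C 3 8) (p : {mpoly C[#|T|]}) :
  poly_value (@ratfun_const C 3 8) (fun t => frac_of (y t)) p =
  frac_of (mmap (@regular_const C 3 8) (fun i => y (enum_val i)) p).
Proof.
rewrite /poly_value /mmap /frac_of rmorph_sum; apply: eq_bigr => m _.
rewrite rmorphM rmorph_prod; congr (_ * _); apply: eq_bigr => i _.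
by rewrite rmorphXn.
Qed.

(** A relation between the initial functions is a polynomial that vanishes at all
    points with nonzero coordinates. *)
Lemma initial_alg_independent : alg_independent (@ratfun_const C 3 8) (extended_cluster s0).
Proof.
move=> p p0; apply/eqP; apply: contraT => /mpoly_nonzero_point[c [c0 pc]].
pose y (r : I + J) := regular_id C (initial_label (row_code r)).
have e : mmap (@regular_const C 3 8) (fun i => y (enum_val i)) p = 0.
  apply/eqP; rewrite -tofrac_eq0 -/(frac_of _) -frac_of_poly_value -p0.
  apply/eqP; rewrite /poly_value /mmap; apply: eq_bigr => m _; congr (_ * _).
  by rewrite /mmap1; apply: eq_bigr => i _; rewrite initial_value.
pose lab (i : 'I_#|{: I + J}|) := initial_label (row_code (enum_val i)).
pose d x := if [pick i | lab i == x] is Some i then c i else 1.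
have dlab i : d (lab i) = c i.
  rewrite /d; case: pickP => [j /eqP|/(_ i)]; last by rewrite eqxx.
  move=> /(uniq_map_inj initial_labels_uniq (row_code_in _) (row_code_in _)).
  by move=> /row_code_inj/enum_val_inj ->.
have [x _|M Md] := @initial_values_free C d.
  by rewrite /d; case: pickP => // *; rewrite oner_neq0.
move/eqP: pc; case; rewrite -[RHS](rmorph0 (value M)) -e /mmap raddf_sum /= mevalE.
apply: eq_bigr => m _; rewrite rmorphM rmorph_prod /= value_const; congr (_ * _).
by apply: eq_bigr => i _; rewrite rmorphXn /= Md ?initial_label_in // -/(lab i) dlab.
Qed.

Lemma id_value_neq0 x : is_cluster_id x -> id_value C x != 0.
Proof.
move=> xc; rewrite /id_value /frac_of tofrac_eq0 regular_id_neq0 //.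
have /id_rangeP[n n16 ->] := mem_cluster_ids xc.
by apply/id_rangeP; exists n => //; lia.
Qed.

Lemma id_value_relations z z' p n k : (z, z', p, n) \in relations ->
  id_value C (rotate k z) * id_value C (rotate k z') =
  monomial_value (id_value C) k p + monomial_value (id_value C) k n.
Proof.
move=> r; rewrite /monomial_value /id_value /frac_of -rmorphM (regular_relations C k r).
by rewrite rmorphD !rmorph_prod.
Qed.

Lemma cluster_id_reached x : is_cluster_id x ->
  exists ms (i : I), cluster (mutate_along ms s0) i = id_value C x.
Proof.
move=> xc; apply: cluster_ids_reached (initial_seed_realized C) (mem_cluster_ids xc).
  exact: id_value_neq0.
exact: id_value_relations.
Qed.

Notation rational_in_initial := (rational_in (@ratfun_const C 3 8) (extended_cluster s0)).

(** Mutation stays in the field generated by the initial seed, and every name is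
    reached by mutations or is the name of a coefficient. *)
Lemma rational_id x : x \in all_ids -> rational_in_initial (id_value C x).
Proof.
move=> /id_rangeP[n n8 ->].
have [n16|n16] := leqP 16 n.
  have [|ms [i <-]] := @cluster_id_reached (Pos.of_nat n).
    have := allP (_ : all is_cluster_id cluster_ids) (Pos.of_nat n).
    apply; first by vm_compute.
    by apply/id_rangeP; exists n => //; lia.
  exact: (rational_mutate_along ms (fun r => rational_var _ _ r) (inl i)).
have n8' : (n - 8 < 8)%N by lia.
have := rational_var (@ratfun_const C 3 8) (extended_cluster s0) (inr (Ordinal n8')).
by rewrite initial_value /row_code /initial_label subnKC //; lia.
Qed.

Definition plucker_triples : seq triple :=
  [seq t <- [seq (ab.1, ab.2, c) | ab <- [seq (a, b) | a <- iota 1 8, b <- iota 1 8], c <- iota 1 8] |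
    (t.1.1 < t.1.2 < t.2)%N].

Definition plucker_id (t : triple) : positive :=
  nth xH all_ids (find (fun x => is_single (formula_of x) &&
    same_members (triple_mem t) (triple_mem (single_triple (formula_of x)))) all_ids).

Lemma plucker_id_correct : all (fun t => [&& plucker_id t \in all_ids,
    is_single (formula_of (plucker_id t)) &
    same_members (triple_mem t) (triple_mem (single_triple (formula_of (plucker_id t))))])
  plucker_triples.
Proof. by vm_compute. Qed.

Lemma three_subset (K : {set 'I_8}) : #|K| = 3 ->
  exists2 t, t \in plucker_triples & forall x : 'I_8, (x \in K) = triple_mem t x.
Proof.
move=> K3; have : sorted (fun i j : 'I_8 => (i < j)%N) (enum K).
  exact: sorted_enum.
have mK x : (x \in K) = (x \in enum K) by rewrite mem_enum.
move: K3 mK; rewrite cardE; case: (enum K) => [|i [|j [|k []]]] //= _ mK /and3P[ij jk _].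
exists (i.+1, j.+1, k.+1); last by move=> x; rewrite mK /triple_mem !inE.
rewrite mem_filter; apply/andP; split; first by rewrite /= !ltnS ij.
have label (r : 'I_8) : r.+1 \in iota 1 8 by rewrite mem_iota; have := ltn_ord r; lia.
apply/allpairsP; exists ((i.+1, j.+1), k.+1); split; [|exact: label|by []].
by apply/allpairsP; exists (i.+1, j.+1); split; [exact: label|exact: label|].
Qed.

Lemma Delta_id (K : {set 'I_8}) t :
  (forall x : 'I_8, (x \in K) = triple_mem t x) -> t \in plucker_triples ->
  plucker_id t \in all_ids /\ Delta C 3 K = regular_id C (plucker_id t).
Proof.
move=> Kt /(allP plucker_id_correct)/and3P[ti single same].
by split; last exact: regular_id_set single Kt same.
Qed.

(** The coordinate ring is generated by the Pluecker coordinates, and each of them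
    has a name. *)
Lemma rational_frac f : rational_in_initial (frac_of f).
Proof.
have [p ->] := coordringP f; elim/mpolyind: p => [|c m p _ _ IH].
  by rewrite /frac_of !rmorph0; exact: rational0.
rewrite /frac_of !rmorphD /=; apply: rationalD => //.
rewrite -mul_mpolyC !rmorphM; apply: rationalM; first exact: (rational_const (@ratfun_const C 3 8)).
rewrite mpolyXE_id !rmorph_prod; apply: rational_prod => i.
rewrite !rmorphXn; apply: rationalX.
have K3 : #|val (enum_val i)| = 3 by apply/eqP; exact: (valP (enum_val i)).
have [t tt Kt] := three_subset K3; have [ti] := Delta_id Kt tt.
rewrite /Delta valK enum_valK => e.
by have := rational_id ti; rewrite /id_value -e.
Qed.

Lemma initial_is_seed : is_seed (@ratfun_const C 3 8) s0.
Proof.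
split; last exact: initial_skew_symmetrizable.
split=> [|f]; first exact: initial_alg_independent.
apply: rational_dependent; have [a [b [_ ->]]] := fraction_quotient f.
by apply: rationalM; [exact: rational_frac|apply: rationalV; exact: rational_frac].
Qed.

End InitialIsSeed.

(** * Lines of the projective plane *)

Section Plane.
Variable R : numFieldType.
Implicit Types (u v w a b c d : 'cV[R]_3).

Definition det3 u v w : R :=
  (u 0 0 * (v 1 0 * w (inord 2) 0 - w 1 0 * v (inord 2) 0)
   - v 0 0 * (u 1 0 * w (inord 2) 0 - w 1 0 * u (inord 2) 0)
   + w 0 0 * (u 1 0 * v (inord 2) 0 - v 1 0 * u (inord 2) 0))%R.

Lemma minor3_det3 (M : 'M[R]_(3, 8)) i j k :
  minor3 M i j k = det3 (col i M) (col j M) (col k M).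
Proof. by rewrite /det3 !mxE /minor3; ring. Qed.

Lemma free_det3 u v w : free [:: u; v; w] = (det3 u v w != 0).
Proof.
pose A : 'M[R]_3 := \matrix_(i, j) [:: u; v; w]`_i j 0.
have detA : \det A = det3 u v w.
  rewrite det_mx33 !mxE /= /det3 !inordK //=; ring.
have combo (k : 'rV[R]_3) : \sum_(i < 3) k 0 i *: [:: u; v; w]`_i = (k *m A)^T.
  apply/matrixP => r s; rewrite summxE !mxE; apply: eq_bigr => i _.
  by rewrite !mxE (ord1 s).
rewrite -detA; apply/idP/idP.
  move=> /(freeP (X := [tuple u; v; w])) fr; apply/negP => /det0P[k k0 kA].
  case/eqP: k0; apply/rowP => i; rewrite mxE; apply: (fr (fun i => k 0 i)).
  by rewrite combo kA trmx0.
move=> dA; apply/(freeP (X := [tuple u; v; w])) => k k0 i.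
pose kr : 'rV[R]_3 := \row_j k j.
have kA : kr *m A = 0.
  apply: trmx_inj; rewrite trmx0 -combo -[RHS]k0; apply: eq_bigr => j _.
  by rewrite mxE.
have := congr1 (fun x : 'rV[R]_3 => x 0 i) (_ : kr = 0); rewrite !mxE; apply.
apply/eqP; apply: contraNT dA => kr0; apply/det0P; by exists kr.
Qed.

Lemma span2 a b : <<[:: a; b]>>%VS = joining_line (proj_point a) (proj_point b).
Proof. by rewrite span_cons span_seq1. Qed.

Lemma mem_joining_line a b x : free [:: a; b] ->
  (x \in joining_line (proj_point a) (proj_point b)) = (det3 x a b == 0).
Proof.
move=> fab; have := free_det3 x a b; rewrite free_cons fab andbT span2.
by move=> /(congr1 negb); rewrite !negbK.
Qed.

Lemma dim_joining_line a b : free [:: a; b] ->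
  \dim (joining_line (proj_point a) (proj_point b)) = 2%N.
Proof. by rewrite -span2 => /eqP. Qed.

Lemma free2 a b : a != 0 -> b != 0 -> proj_point a != proj_point b -> free [:: a; b].
Proof.
move=> a0 b0 ab; rewrite free_cons seq1_free b0 andbT span_seq1.
apply: contra ab => /vlineP[k ak].
have k0 : k != 0 by apply: contraNneq a0 => k0; rewrite ak k0 scale0r.
by rewrite /proj_point eqEdim !dim_vline a0 b0 leqnn andbT -memvE ak memvZ ?memv_line.
Qed.

(** The combination of a and b is chosen so that its determinant with c and d
    vanishes; it is not zero because the lines differ. *)
Lemma intersection_of_lines a b c d : free [:: a; b] -> free [:: c; d] ->
  joining_line (proj_point a) (proj_point b) != joining_line (proj_point c) (proj_point d) ->
  intersection_point (joining_line (proj_point a) (proj_point b))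
    (joining_line (proj_point c) (proj_point d)) =
  proj_point (det3 b c d *: a - det3 a c d *: b).
Proof.
move=> fab fcd; set l := joining_line (proj_point a) _; set m := joining_line (proj_point c) _ => lm.
set x := (_ - _)%R.
have [al bl] : a \in l /\ b \in l.
  by split; rewrite memvE; [exact: addvSl|exact: addvSr].
have xl : x \in l by rewrite memvB ?memvZ.
have xm : x \in m by rewrite mem_joining_line // /x /det3 !mxE; apply/eqP; ring.
have l2 : \dim l = 2%N := dim_joining_line fab.
have m2 : \dim m = 2%N := dim_joining_line fcd.
have lNm : ~~ (l <= m)%VS by apply: contra lm => lm; rewrite eqEdim lm l2 m2.
have x0 : x != 0.
  apply: contra lNm => /eqP x0.
  have /(freeP (X := [tuple a; b])) fr := fab.
  pose k (i : 'I_2) : R := if i == 0 then det3 b c d else - det3 a c d.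
  have k0 : forall i, k i = 0.
    by apply: fr; rewrite !big_ord_recl big_ord0 /k /= addr0 scaleNr.
  have b0 : det3 b c d = 0 := k0 0.
  have a0 : det3 a c d = 0 by have := k0 1; rewrite /k /= => /eqP; rewrite oppr_eq0 => /eqP.
  by rewrite subv_add -!memvE !mem_joining_line // a0 b0 eqxx.
apply/esym/eqP; rewrite eqEdim dim_vline x0 subv_cap -!memvE xl xm /=.
have : (\dim (l :&: m)%VS < \dim l)%N.
  rewrite ltnNge; apply: contra lNm => h.
  have /eqP -> : l == (l :&: m)%VS by rewrite eq_sym eqEdim capvSl h.
  exact: capvSr.
by rewrite l2 ltnS.
Qed.

(** The points may coincide, because a subspace of dimension at most 2 is contained
    in one of dimension 2. *)
Lemma collinear_det3 u v w :
  collinear (proj_point u) (proj_point v) (proj_point w) <-> det3 u v w = 0.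
Proof.
have -> : det3 u v w = 0 <-> ~~ free [:: u; v; w] by rewrite free_det3 negbK; split=> [->|/eqP].
split.
  move=> [l [l2 [ul [vl wl]]]]; rewrite /free neq_ltn; apply/orP; left.
  rewrite ltnS; apply: leq_trans (_ : \dim l <= 2)%N; last by rewrite l2.
  apply: dimvS; rewrite !span_cons span_nil addv0 !subv_add; apply/and3P; split=> //.
move=> nf; have d2 : (\dim <<[:: u; v; w]>>%VS <= 2)%N.
  by move: nf; rewrite /free neq_ltn ltnS => /orP[//|]; rewrite ltnNge dim_span.
have extend (U : {vspace 'cV[R]_3}) n : (\dim U + n = 2)%N -> exists2 l, (U <= l)%VS & \dim l = 2%N.
  elim: n U => [|n IH] U Un; first by exists U => //; move: Un; rewrite addn0.
  have [x xU] : exists x, x \notin U.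
    have : ~~ (fullv <= U)%VS.
      by apply/negP => /dimvS; rewrite dimvf /dim /=; lia.
    by move=> /subvPn[x _ xU]; exists x.
  have [|l Ul l2] := IH (<[x]> + U)%VS.
    have le : (\dim (<[x]> + U) <= (x != 0%R) + \dim U)%N by rewrite -dim_vline dimv_add_leqif.
    have : (\dim U < \dim (<[x]> + U))%N.
      rewrite ltnNge; apply/negP => h; move/negP: xU; apply.
      have /eqP -> : U == (<[x]> + U)%VS by rewrite eqEdim addvSr h.
      by rewrite memvE addvSl.
    by move: le; case: (x != 0%R); lia.
  by exists l => //; apply: subv_trans Ul; exact: addvSr.
have [l Ul l2] := extend _ (2 - \dim <<[:: u; v; w]>>%VS)%N (subnKC d2).
exists l; split=> //; move: Ul; rewrite !span_cons span_nil addv0 !subv_add.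
by move=> /and3P[].
Qed.

End Plane.

(** * The families of cluster variables *)

Local Open Scope card_scope.

(** The name of a function is recognized from its value at the sample matrix; the
    equality is then verified separately ([equals_id]). *)
Definition id_of_formula (f : plucker_formula) : positive :=
  nth xH all_ids (index (Z.abs_N (sample_value f)) sample_absolute_values).

Definition equals_id (f : plucker_formula) (x : positive) : bool :=
  formula_wf f && same_polynomial (formula_expr chart_entries f) (formula_expr chart_entries (formula_of x)).

Definition is_internal_triple (t : triple) : bool :=
  ~~ has (fun a : nat => same_members (triple_mem t) (cyclic_interval_mem (a.+1)%:Z 3)) (iota 0 8).

Definition internal_triples : seq triple := filter is_internal_triple plucker_triples.

Lemma internal_triples_ids : all (mem (map plucker_id internal_triples)) (id_range 16 48) &&
  all (mem (id_range 16 48)) (map plucker_id internal_triples).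
Proof. by vm_compute. Qed.

Lemma plucker_triples_size : all (fun t => count (triple_mem t) (iota 0 8) == 3) plucker_triples.
Proof. by vm_compute. Qed.

Definition label_pairs : seq (nat * nat) :=
  [seq ij <- [seq (i, j) | i <- iota 1 8, j <- iota 1 8] | (ij.1 < ij.2)%N].

Definition quadratic_formulas : seq plucker_formula :=
  [seq formula_X (label_without ij.1 ij.2) | ij <- label_pairs] ++
  [seq formula_Y (label_without ij.1 ij.2) | ij <- label_pairs].

Lemma quadratic_formulas_ids :
  all (fun f => equals_id f (id_of_formula f)) quadratic_formulas.
Proof. by vm_compute. Qed.

Lemma quadratic_formulas_range :
  all (mem (map id_of_formula quadratic_formulas)) (id_range 64 56) &&
  all (mem (id_range 64 56)) (map id_of_formula quadratic_formulas).
Proof. by vm_compute. Qed.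

(** 127 belongs to the orbit of A, and 136 is the name given to the reflection of B. *)
Lemma reflected_cubic_ids :
  equals_id (reflect_formula formula_A) 127 && equals_id (reflect_formula formula_B) 136.
Proof. by vm_compute. Qed.

Lemma card_members (K : {set 'I_8}) (a : nat -> bool) :
  (forall x : 'I_8, (x \in K) = a x) -> #|K| = count a (iota 0 8).
Proof.
move=> Ka; rewrite cardE /enum_mem -enumT size_filter -(val_enum_ord 8) count_map.
exact: eq_count.
Qed.

Section Families.
Variable C : numFieldType.
Notation I := ('I_2 * 'I_4)%type.
Notation J := 'I_8.
Notation s0 := (grassmannian_seed C 3 8 : seed_data (ratfun C 3 8) I J).

Definition id_set (ids : seq positive) : set (ratfun C 3 8) :=
  [set f | exists2 x, x \in ids & f = id_value C x].

Lemma id_value_inj : {in all_ids &, injective (id_value C)}.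
Proof.
move=> x y xi yi /eqP; rewrite /id_value /frac_of tofrac_eq => /eqP.
exact: regular_id_inj.
Qed.

Lemma id_range_sub a n : (8 <= a)%N -> (a + n <= 144)%N -> {subset id_range a n <= all_ids}.
Proof.
by move=> a8 an x /id_rangeP[i ia ->]; apply/id_rangeP; exists i => //; lia.
Qed.

Lemma mem_id_range a n i : (0 < i)%N -> (0 < a)%N ->
  (Pos.of_nat i \in id_range a n) = (a <= i < a + n)%N.
Proof.
move=> i0 a0; apply/id_rangeP/idP => [[j ja]|ia].
  move=> /(congr1 Pos.to_nat); rewrite !Nat2Pos.id; [by move=> ->|lia|lia].
by exists i.
Qed.

Lemma card_id_range a n : (8 <= a)%N -> (a + n <= 144)%N -> id_set (id_range a n) #= `I_n.
Proof.
move=> a8 an; pose f i := id_value C (Pos.of_nat (a + i)).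
have -> : id_set (id_range a n) = [set f i | i in `I_n]%classic.
  apply/seteqP; split=> g.
    move=> [x /id_rangeP[i ia ->] ->].
    exists (i - a)%N; first by rewrite /=; lia.
    by rewrite /f subnKC //; lia.
  move=> [i /= ni <-]; exists (Pos.of_nat (a + i)) => //.
  by rewrite mem_id_range; lia.
apply: inj_card_eq => i j; rewrite !inE /= => ni nj /id_value_inj h.
have ij : Pos.of_nat (a + i) = Pos.of_nat (a + j).
  by apply: h; apply: (id_range_sub a8 an); rewrite mem_id_range; lia.
by move/(congr1 Pos.to_nat): ij; rewrite !Nat2Pos.id; lia.
Qed.

Lemma mutation_equivalent_along ms : mutation_equivalent (@ratfun_const C 3 8) s0 (mutate_along ms s0).
Proof.
have : mutation_equivalent (@ratfun_const C 3 8) s0 s0.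
  by constructor; exact: initial_is_seed.
by move: {2 4}s0; elim: ms => [|i ms IH] s sm //=; apply: IH; constructor.
Qed.

(** One inclusion is the exhaustive search, the other the bipartite belt. *)
Lemma cluster_variables_ids : grassmannian_cluster_variable C 3 8 = id_set (id_range 16 128).
Proof.
apply/seteqP; split=> f.
  move=> [s [i [sm ->]]].
  have [x xc ->] := realizes_exploration (@id_value_neq0 C) (@id_value_relations C)
    (initial_seed_realized C) sm i.
  by exists x => //; exact: mem_cluster_ids.
move=> [x xc ->]; have [ms [i <-]] := cluster_ids_reached (@id_value_neq0 C) (@id_value_relations C)
  (initial_seed_realized C) xc.
by exists (mutate_along ms s0), i; split=> //; exact: mutation_equivalent_along.
Qed.

Lemma pluckers_ids :
  [set f | exists2 K : {set 'I_8}, internal 3 K & f = frac_of (Delta C 3 K)]%classic = id_set (id_range 16 48).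
Proof.
have internalE (K : {set 'I_8}) t : (forall x : 'I_8, (x \in K) = triple_mem t x) ->
    t \in plucker_triples -> internal 3 K = is_internal_triple t.
  move=> Kt tt; rewrite /internal (card_members Kt) (eqP (allP plucker_triples_size t tt)) eqxx /=.
  congr negb; apply/existsP/hasP => [[a Ka]|[a]].
    exists (a : nat); first by rewrite mem_iota ltn_ord.
    by move: Ka; rewrite (eq_set_members Kt (mem_cyclic_interval _ _)).
  rewrite mem_iota => /andP[_ a8] h; exists (Ordinal a8).
  by rewrite (eq_set_members Kt (mem_cyclic_interval _ _)).
have /andP[/allP sub1 /allP sub2] := internal_triples_ids.
apply/seteqP; split=> f.
  move=> [K Kint ->]; have K3 : #|K| = 3 by case/andP: Kint => /eqP.
  have [t tt Kt] := three_subset K3; have [_ ->] := Delta_id C Kt tt.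
  exists (plucker_id t) => //; apply: sub2; apply: map_f.
  by rewrite mem_filter tt andbT -(internalE K).
move=> [x /sub1/mapP[t]]; rewrite mem_filter => /andP[tint tt] -> ->.
pose K := [set x : 'I_8 | triple_mem t x].
have Kt x' : (x' \in K) = triple_mem t x' by rewrite inE.
by exists K; [rewrite (internalE K t)|have [_ ->] := Delta_id C Kt tt].
Qed.

Lemma equals_idP f x : equals_id f x -> regular_of C f = regular_id C x.
Proof.
move=> /andP[wf]; apply: same_polynomial_regular => //; exact: formula_of_wf.
Qed.

Lemma regular_of_cons s ts f : regular_of C ((s, ts) :: f) =
  (-1) ^+ s * (\prod_(t <- ts) Delta3 C 8 t.1.1 t.1.2 t.2) + regular_of C f.
Proof. by rewrite /regular_of big_cons. Qed.

Lemma regular_of_nil : regular_of C [::] = 0.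
Proof. by rewrite /regular_of big_nil. Qed.

Lemma complement_labels (i j : 'I_8) r :
  complement_label [set i; j] r = label_without i.+1 j.+1 r.
Proof.
rewrite /complement_label /label_without; congr nth.
have -> : iota 1 8 = [seq (x : 'I_8).+1 | x <- enum 'I_8].
  by rewrite (iotaDl 1 0 8) -(val_enum_ord 8) -map_comp.
rewrite filter_map; congr map; rewrite {1}/enum_mem -enumT.
by apply: eq_filter => x; rewrite !inE negb_or.
Qed.

Lemma X_minus_formula (i j : 'I_8) :
  X_minus C [set i; j] = regular_of C (formula_X (label_without i.+1 j.+1)).
Proof.
rewrite /X_minus !complement_labels !regular_of_cons regular_of_nil.
by rewrite !big_cons !big_nil /=; ring.
Qed.

Lemma Y_minus_formula (i j : 'I_8) :
  Y_minus C [set i; j] = regular_of C (formula_Y (label_without i.+1 j.+1)).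
Proof.
rewrite /Y_minus !complement_labels !regular_of_cons regular_of_nil.
by rewrite !big_cons !big_nil /=; ring.
Qed.

Lemma cubicA_formula : cubicA C = regular_of C formula_A.
Proof. by rewrite !regular_of_cons regular_of_nil !big_cons !big_nil /cubicA /=; ring. Qed.

Lemma cubicB_formula : cubicB C = regular_of C formula_B.
Proof. by rewrite !regular_of_cons regular_of_nil !big_cons !big_nil /cubicB /=; ring. Qed.

Lemma quadratics_ids :
  [set f | exists i j : 'I_8, (i < j)%N /\
       (f = frac_of (X_minus C [set i; j]%SET) \/
        f = frac_of (Y_minus C [set i; j]%SET))]%classic = id_set (id_range 64 56).
Proof.
have /andP[/allP sub1 /allP sub2] := quadratic_formulas_range.
have pair (i j : 'I_8) : (i < j)%N -> (i.+1, j.+1) \in label_pairs.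
  move=> ij; rewrite mem_filter; apply/andP; split; first by rewrite ltnS.
  have label (r : 'I_8) : r.+1 \in iota 1 8 by rewrite mem_iota; have := ltn_ord r; lia.
  by apply/allpairsP; exists (i.+1, j.+1); split; [exact: label|exact: label|].
have unpair ij : ij \in label_pairs -> exists i j : 'I_8, (i < j)%N /\ ij = (i.+1, j.+1).
  rewrite mem_filter => /andP[lt /allpairsP[[i j] []]]; rewrite !mem_iota /= => i8 j8 e.
  have i8' : (i.-1 < 8)%N by lia.
  have j8' : (j.-1 < 8)%N by lia.
  exists (Ordinal i8'), (Ordinal j8'); move: lt; rewrite e => /= lt.
  by split; [lia|congr (_, _); rewrite prednK; lia].
apply/seteqP; split=> f.
  move=> [i [j [/pair ij]]] fXY.
  have [g gq ->] : exists2 g, g \in quadratic_formulas & f = frac_of (regular_of C g).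
    case: fXY => ->; [rewrite X_minus_formula|rewrite Y_minus_formula].
      exists (formula_X (label_without i.+1 j.+1)) => //; rewrite mem_cat; apply/orP; left.
      exact: (map_f (fun ij => formula_X (label_without ij.1 ij.2)) ij).
    exists (formula_Y (label_without i.+1 j.+1)) => //; rewrite mem_cat; apply/orP; right.
    exact: (map_f (fun ij => formula_Y (label_without ij.1 ij.2)) ij).
  exists (id_of_formula g); first by apply: sub2; exact: map_f.
  by rewrite (equals_idP (allP quadratic_formulas_ids g gq)).
move=> [x /sub1/mapP[g gq ->] ->]; rewrite /id_value -(equals_idP (allP quadratic_formulas_ids g gq)).
move: gq; rewrite mem_cat => /orP[] /mapP[ij /unpair[i [j [lt ->]]] ->];
  exists i, j; split=> //; [left; rewrite X_minus_formula|right; rewrite Y_minus_formula]; by [].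
Qed.

Lemma id_setU a m n : (id_set (id_range a m) `|` id_set (id_range (a + m) n))%classic = id_set (id_range a (m + n)).
Proof.
rewrite /id_range iotaD map_cat; apply/seteqP; split=> f.
  by move=> [[x xi ->]|[x xi ->]]; exists x => //; rewrite mem_cat xi ?orbT.
by move=> [x]; rewrite mem_cat => /orP[xi|xi] ->; [left|right]; exists x.
Qed.

Lemma remaining_ids :
  (id_set (id_range 16 128) `\` (id_set (id_range 16 48) `|` id_set (id_range 64 56)))%classic =
  id_set (id_range 120 24).
Proof.
rewrite (id_setU 16 48 56); apply/seteqP; split=> f.
  move=> [[x /id_rangeP[i ii ->] ->] nf].
  exists (Pos.of_nat i) => //; rewrite mem_id_range; [|lia|lia].
  have [lt|ge] := ltnP i 120; last by lia.
  by case: nf; exists (Pos.of_nat i) => //; rewrite mem_id_range; lia.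
move=> [x /id_rangeP[i ii ->] ->]; split.
  by exists (Pos.of_nat i) => //; rewrite mem_id_range; lia.
move=> [y /id_rangeP[j jj ->] /id_value_inj h].
have : Pos.of_nat i = Pos.of_nat j.
  by apply: h; apply/id_rangeP; [exists i|exists j] => //; lia.
by move/(congr1 Pos.to_nat); rewrite !Nat2Pos.id; lia.
Qed.

End Families.

(** * Dihedral translates *)

Section Dihedral.
Variable C : numFieldType.
Implicit Types (M : 'M[C]_(3, 8)) (g : coordring C 3 8) (s r : 'S_8).

Definition rotation_by (c : nat) s : Prop := forall x, s x = ((x + c) %% 8)%N :> nat.

Definition reflection_by (c : nat) s : Prop :=
  exists2 r, rotation_by c r & forall x, s x = r (rev_ord x).

Lemma dihedral_cases s : s \in dihedral 8 <->
  exists c, rotation_by c s \/ reflection_by c s.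
Proof.
have refl c (x : 'I_8) : ((c + 8 - x) %% 8 = (rev_ord x + c.+1) %% 8)%N.
  by congr (_ %% 8)%N; rewrite /=; have := ltn_ord x; lia.
rewrite inE; split.
  move=> /existsP[c /orP[/forallP h|/forallP h]].
    by exists c; left => x; apply/eqP.
  have [r rc] := rotation_exists c.+1; exists c.+1; right; exists r => // x.
  by apply: ord_inj; rewrite (eqP (h x)) rc refl.
have c8 c : (c %% 8 < 8)%N by rewrite ltn_pmod.
move=> [c [sc|[r rc sr]]].
  apply/existsP; exists (Ordinal (c8 c)); apply/orP; left; apply/forallP => x.
  by rewrite sc /= modnDmr.
apply/existsP; exists (Ordinal (c8 (c + 7)%N)); apply/orP; right; apply/forallP => x.
rewrite sr rc refl; move: (nat_of_ord (rev_ord x)) => y /=.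
rewrite -addSnnS -[in X in _ == X]modnDmr modn_mod modnDmr.
by rewrite (_ : y.+1 + (c + 7) = y + c + 8)%N ?modnDr //; lia.
Qed.

Lemma column_translate_unique s f g g' :
  column_translate s f g -> column_translate s f g' -> g = g'.
Proof. by move=> h h'; apply: coordring_ext => M; rewrite /value h h'. Qed.

Lemma rotation_translate c s x : rotation_by c s ->
  column_translate s (regular_id C x) (regular_id C (rotate c x)).
Proof. by move=> sc M; exact: (value_regular_id_rotate M x sc). Qed.

Definition is_cubic (f : plucker_formula) : bool := all (fun m => size m.2 == 3) f.

Definition is_increasing (f : plucker_formula) : bool :=
  all (fun m => all (fun t : triple => [&& 0 < t.1.1, t.1.1 < t.1.2, t.1.2 < t.2 & t.2 <= 8]%N) m.2) f.

(** The reflection reverses each of the three triples of a monomial of degree 3,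
    hence the sign. *)
Lemma value_reflected c s r M f : is_cubic f -> is_increasing f -> rotation_by c r ->
  (forall x, s x = r (rev_ord x)) ->
  value (col_perm s M) (regular_of C f) = - value (col_perm r M) (regular_of C (reflect_formula f)).
Proof.
move=> cub inc rc sr; rewrite !value_regular_of big_map -sumrN big_seq [RHS]big_seq.
apply: eq_bigr => -[b ts] mf; have /eqP /= ts3 := allP cub _ mf.
have /allP /= tsinc := allP inc _ mf.
rewrite -mulrN; congr (_ * _); rewrite big_map.
have neg3 (F : triple -> C) : - \prod_(t <- ts) F t = \prod_(t <- ts) - F t.
  by case: ts ts3 {mf tsinc} => [|t1 [|t2 [|t3 []]]] //= _; rewrite !big_cons !big_nil; ring.
rewrite neg3.
rewrite [LHS]big_seq [RHS]big_seq; apply: eq_bigr => -[[x y] z] /tsinc /= h.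
rewrite !value_Delta3_label /cyclically_ordered; try lia.
have sE k : (k < 8)%N -> s (inord k) = r (inord (7 - k)).
  move=> k8; rewrite sr; congr (r _); apply: val_inj.
  by rewrite /= !inordK; lia.
rewrite /minor3 !mxE !sE; try lia.
have E k : (0 < k <= 8)%N -> (7 - k.-1 = (9 - k).-1)%N by lia.
rewrite !E; try lia.
by ring.
Qed.

Lemma regular_of_reflected c s f x :
  is_cubic f -> is_increasing f -> equals_id (reflect_formula f) x -> reflection_by c s ->
  column_translate s (regular_of C f) (- regular_id C (rotate c x)).
Proof.
move=> cub inc fx [r rc sr] M.
have := value_reflected M cub inc rc sr; rewrite (equals_idP C fx).
rewrite -(value_regular_id_rotate M x rc) /value => ->.
exact: (raddfN (value M)).
Qed.

Lemma cubic_ids_rotate (k : nat) (x : positive) : x \in id_range 120 24 ->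
  rotate k x \in id_range 120 24.
Proof.
have one : all (fun y => rotate1 y \in id_range 120 24) (id_range 120 24) by vm_compute.
by move=> xi; elim: k => [|k IH] //=; exact: (allP one).
Qed.

Lemma formula_A_cubic : is_cubic formula_A /\ is_increasing formula_A.
Proof. by []. Qed.

Lemma formula_B_cubic : is_cubic formula_B /\ is_increasing formula_B.
Proof. by []. Qed.

Lemma cubic_formulas_ids : regular_of C formula_A = regular_id C 120 /\
  regular_of C formula_B = regular_id C 128.
Proof. by split; apply: equals_idP; vm_compute. Qed.

Definition cubic_translate g : Prop :=
  dihedral_translate (cubicA C) g \/ dihedral_translate (cubicB C) g.

Lemma cubic_translate_id g : cubic_translate g ->
  exists2 x, x \in id_range 120 24 & g = regular_id C x \/ g = - regular_id C x.
Proof.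
have [eA eB] := cubic_formulas_ids; have /andP[rA rB] := reflected_cubic_ids.
have [cA iA] := formula_A_cubic; have [cB iB] := formula_B_cubic.
have a1 : 120%positive \in id_range 120 24 by vm_compute.
have a2 : 128%positive \in id_range 120 24 by vm_compute.
have a3 : 127%positive \in id_range 120 24 by vm_compute.
have a4 : 136%positive \in id_range 120 24 by vm_compute.
rewrite /cubic_translate cubicA_formula cubicB_formula.
case=> -[s /dihedral_cases[c [sc|sc]] tr].
- exists (rotate c 120); first exact: cubic_ids_rotate.
  by left; apply: column_translate_unique tr _; rewrite eA; exact: rotation_translate.
- exists (rotate c 127); first exact: cubic_ids_rotate.
  by right; exact: column_translate_unique tr (regular_of_reflected cA iA rA sc).
- exists (rotate c 128); first exact: cubic_ids_rotate.
  by left; apply: column_translate_unique tr _; rewrite eB; exact: rotation_translate.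
- exists (rotate c 136); first exact: cubic_ids_rotate.
  by right; exact: column_translate_unique tr (regular_of_reflected cB iB rB sc).
Qed.

Lemma id_cubic_translate x : x \in id_range 120 24 ->
  exists2 g, cubic_translate g & regular_id C x = g \/ regular_id C x = - g.
Proof.
have [eA eB] := cubic_formulas_ids; have /andP[_ rB] := reflected_cubic_ids.
have [cB iB] := formula_B_cubic.
have cover : all (fun x => has (fun k => [|| x == rotate k 120, x == rotate k 128 |
    x == rotate k 136]) (iota 0 8)) (id_range 120 24) by vm_compute.
move=> /(allP cover)/hasP[k _]; have [r rk] := rotation_exists k.
have rD : r \in dihedral 8 by apply/dihedral_cases; exists k; left.
rewrite /cubic_translate cubicA_formula cubicB_formula.
case/or3P => /eqP ->.
- exists (regular_id C (rotate k 120)); last by left.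
  by left; exists r; [exact: rD|rewrite eA; exact: rotation_translate].
- exists (regular_id C (rotate k 128)); last by left.
  by right; exists r; [exact: rD|rewrite eB; exact: rotation_translate].
exists (- regular_id C (rotate k 136)); last by right; rewrite opprK.
pose s : 'S_8 := (perm (@rev_ord_inj 8) * r)%g.
have sr x' : s x' = r (rev_ord x') by rewrite permM permE.
right; exists s; first by apply/dihedral_cases; exists k; right; exists r.
have refl : reflection_by k s by exists r.
exact: regular_of_reflected cB iB rB refl.
Qed.

End Dihedral.

(** * The zero locus of A *)

Section ZeroLocus.
Variable R : realType.

Lemma minor3_map (M : 'M[R]_(3, 8)) i j k :
  minor3 (map_mx (fun x : R => x%:C%C) M) i j k = (minor3 M i j k)%:C%C.
Proof. by rewrite /minor3 !mxE -!(rmorphM, rmorphB, rmorphD) /=. Qed.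

Lemma det3_pencils (K : numFieldType) (a b c d : K) (u v w x : 'cV[K]_3) :
  det3 (a *: u - b *: v) (c *: u - d *: w) x =
  b * d * det3 v w x + b * c * det3 u v x - a * d * det3 u w x.
Proof. by rewrite /det3 !mxE; ring. Qed.

(** p and q are the points given by [intersection_of_lines]. *)
Lemma cubicA_det3 (M : 'M[R]_(3, 8)) (v := fun l => col (inord l.-1) M)
  (p := det3 (v 2%N) (v 3%N) (v 4%N) *: v 1%N - det3 (v 1%N) (v 3%N) (v 4%N) *: v 2%N)
  (q := det3 (v 8%N) (v 6%N) (v 7%N) *: v 1%N - det3 (v 1%N) (v 6%N) (v 7%N) *: v 8%N) :
  value (map_mx (fun x : R => x%:C%C) M) (cubicA R[i]) = (- det3 p q (v 5%N))%:C%C.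
Proof.
rewrite cubicA_formula value_regular_of !big_cons !big_nil /=.
rewrite !value_Delta3_label // !minor3_map !mulr1 !addr0 !expr1 !expr0 !mulN1r !mul1r.
rewrite -!rmorphM -!rmorphN -!rmorphD /=; congr (_%:C%C).
rewrite !minor3_det3 /= -!/(v _) /p /q det3_pencils.
have rot a b c : det3 (v a) (v b) (v c) = det3 (v b) (v c) (v a) by rewrite /det3; ring.
have swap a b c : det3 (v a) (v b) (v c) = - det3 (v a) (v c) (v b) by rewrite /det3; ring.
rewrite (rot 8 6 7)%N (swap 2 8 5)%N (swap 1 8 5)%N.
by ring.
Qed.

End ZeroLocus.

Unset Implicit Arguments.
Local Open Scope complex_scope.
Local Open Scope card_scope.
Local Open Scope classical_set_scope.

Theorem theorem8 (R : realType) :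
  let cluster_variables : set (ratfun R[i] 3 8) :=
    grassmannian_cluster_variable R[i] 3 8 in
  let pluckers : set (ratfun R[i] 3 8) :=
    [set f | exists2 K : {set 'I_8}, internal 3 K & f = frac_of (Delta R[i] 3 K)] in
  let quadratics : set (ratfun R[i] 3 8) :=
    [set f | exists i j : 'I_8, (i < j)%N /\
       (f = frac_of (X_minus R[i] [set i; j]%SET) \/
        f = frac_of (Y_minus R[i] [set i; j]%SET))] in
  let remaining : set (ratfun R[i] 3 8) :=
    cluster_variables `\` (pluckers `|` quadratics) in
  let translate_of_A_or_B (g : coordring R[i] 3 8) : Prop :=
    dihedral_translate (cubicA R[i]) g \/ dihedral_translate (cubicB R[i]) g in
  cluster_variables #= `I_128 /\
  (pluckers #= `I_48 /\ pluckers `<=` cluster_variables) /\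
  (quadratics #= `I_56 /\ quadratics `<=` cluster_variables) /\
  (remaining #= `I_24 /\
   (forall f, remaining f -> exists2 g, translate_of_A_or_B g &
      f = frac_of g \/ f = - frac_of g) /\
   (forall g, translate_of_A_or_B g ->
      remaining (frac_of g) \/ remaining (- frac_of g))) /\
  (forall M : 'M[R]_(3, 8),
     let v (l : nat) : 'cV[R]_3 := col (inord l.-1) M in
     let pt (l : nat) := proj_point (v l) in
     let line (l m : nat) := joining_line (pt l) (pt m) in
     let p := intersection_point (line 1%N 2%N) (line 3%N 4%N) in
     let q := intersection_point (line 1%N 8%N) (line 6%N 7%N) in
     (forall j, col j M != 0) ->
     pt 1%N != pt 2%N -> pt 3%N != pt 4%N -> line 1%N 2%N != line 3%N 4%N ->
     pt 1%N != pt 8%N -> pt 6%N != pt 7%N -> line 1%N 8%N != line 6%N 7%N ->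
     (regular_eval (cubicA R[i]) (plucker (map_mx (fun x : R => x%:C) M)) = 0 <->
      collinear p q (pt 5%N))).
Proof.
move=> cluster_variables pluckers quadratics remaining translate_of_A_or_B.
have cv : cluster_variables = @id_set R[i] (id_range 16 128) := cluster_variables_ids R[i].
have pl : pluckers = @id_set R[i] (id_range 16 48) := pluckers_ids R[i].
have qu : quadratics = @id_set R[i] (id_range 64 56) := quadratics_ids R[i].
have re : remaining = @id_set R[i] (id_range 120 24).
  by rewrite /remaining cv pl qu remaining_ids.
rewrite re cv pl qu.
have sub a n : (16 <= a)%N -> (a + n <= 144)%N ->
    @id_set R[i] (id_range a n) `<=` @id_set R[i] (id_range 16 128).
  move=> a16 an f [x /id_rangeP[i ia ->] ->]; exists (Pos.of_nat i) => //.
  by rewrite mem_id_range; lia.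
split; first exact: card_id_range.
split; first by split; [exact: card_id_range|exact: sub].
split; first by split; [exact: card_id_range|exact: sub].
split.
  split; first exact: card_id_range.
  split=> [f [x xi ->]|g /cubic_translate_id[x xi [->|->]]].
  - have [g tg xg] := id_cubic_translate R[i] xi; exists g; first exact: tg.
    by case: xg => e; [left|right]; rewrite /id_value e // /frac_of rmorphN.
  - by left; exists x.
  - by right; exists x; rewrite // /frac_of rmorphN opprK.
move=> M v pt line p q v0 n12 n34 nl n18 n67 nm.
have nz l : v l != 0 by exact: v0.
have f2 l m : pt l != pt m -> free [:: v l; v m] by apply: free2.
have pE := intersection_of_lines (f2 _ _ n12) (f2 _ _ n34) nl.
have qE := intersection_of_lines (f2 _ _ n18) (f2 _ _ n67) nm.
rewrite -/(value _ _) cubicA_det3 /p /q /line /pt pE qE.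
apply: iff_trans (iff_sym (collinear_det3 _ _ _)).
split=> [/eqP|->]; last by rewrite oppr0.
by rewrite (fmorph_eq0 (real_complex R)) oppr_eq0 => /eqP.
Qed.
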